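(* Let $R$ be a commutative local ring. Then the following are equivalent: (i) the ring $R[t]$ is Hermite; (ii) the ring $R[t,t^{-1}]$ is Hermite; (iii) the ring $R\langle t\rangle$ is Hermite; (iv) the ring $R(\!(t)\!)$ is Hermite.
   Context: A finitely generated projective $A$-module $P$ is stably free if there exist $m,n\in\mathbb{N}$ with $P\oplus A^m\cong A^n$. A commutative ring $A$ is called Hermite if all finitely generated stably free $A$-modules are free. Local rings are not assumed noetherian. For a commutative ring $R$: $R[t,t^{-1}]$ is the ring of Laurent polynomials; $R\langle t\rangle$ is the localization of $R[t]$ at the multiplicative set of monic polynomials; $R(\!(t)\!)=R[[t]]_t$ is the ring of formal Laurent series in one variable. *)

(* Defs.v *)
From HB Require Import structures.
From mathcomp Require Import all_boot all_algebra.
From mathcomp Require Import boolp.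
From mathcomp Require Import ring.

Set Implicit Arguments.
Unset Strict Implicit.
Unset Printing Implicit Defensive.

Import GRing.Theory.
Local Open Scope ring_scope.
Local Open Scope quotient_scope.

(* [idealr_closed] includes [1 \notin m]: it describes proper ideals. *)
Definition maximal_ideal (R : comNzRingType) (m : {pred R}) : Prop :=
  idealr_closed m /\
  forall J : {pred R}, idealr_closed J -> {subset m <= J} -> {subset J <= m}.

Definition local_ring (R : comNzRingType) : Prop :=
  exists2 m : {pred R}, maximal_ideal m &
    forall m' : {pred R}, maximal_ideal m' -> m' =i m.

Section Modules.
Variable A : comPzRingType.

Definition fin_gen (P : lmodType A) : Prop :=
  exists (n : nat) (v : 'I_n -> P),
    forall x : P, exists c : 'I_n -> A, x = \sum_(i < n) c i *: v i.

Definition projective (P : lmodType A) : Prop :=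
  forall (M N : lmodType A) (g : {linear M -> N}) (f : {linear P -> N}),
    (forall y : N, exists x : M, g x = y) ->
    exists h : {linear P -> M}, forall x : P, g (h x) = f x.

Definition lmod_iso (M N : lmodType A) : Prop :=
  exists f : {linear M -> N}, bijective f.

Definition stably_free (P : lmodType A) : Prop :=
  exists m n : nat, lmod_iso (P * 'rV[A]_m)%type 'rV[A]_n.

(* The basis [B] may be infinite; the sequences [s] range over its finite
   subfamilies. *)
Definition free_module (P : lmodType A) : Prop :=
  exists B : P -> Prop,
    (forall (s : seq P) (c : P -> A),
       uniq s -> (forall b, b \in s -> B b) ->
       \sum_(b <- s) c b *: b = 0 -> forall b, b \in s -> c b = 0) /\
    (forall x : P, exists (s : seq P) (c : P -> A),
       (forall b, b \in s -> B b) /\ x = \sum_(b <- s) c b *: b).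

Definition Hermite : Prop :=
  forall P : lmodType A,
    fin_gen P -> projective P -> stably_free P -> free_module P.

End Modules.

(* The localization of [A] at a multiplicative set [S]; [S] may contain zero
   divisors, so [a / s = b / t] means [u * (a * t) = u * (b * s)] for some
   [u] in [S]. *)
Module Localization.
Section Localization.
Variables (A : comPzRingType) (S : mulrClosed A).

Record ratio := Ratio { num : A; den : A; den_in : den \in S }.

HB.instance Definition _ := gen_eqMixin ratio.
HB.instance Definition _ := gen_choiceMixin ratio.

Definition equivl (x y : ratio) : bool :=
  `[< exists2 u, u \in S & u * (num x * den y) = u * (num y * den x) >].

Lemma equivlP x y :
  reflect (exists2 u, u \in S & u * (num x * den y) = u * (num y * den x))
          (equivl x y).
Proof. exact: asboolP. Qed.

Lemma equivl_refl : reflexive equivl.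
Proof. by move=> x; apply/equivlP; exists 1; rewrite ?rpred1. Qed.

Lemma equivl_sym : symmetric equivl.
Proof.
by move=> x y; apply/equivlP/equivlP => -[u uS e]; exists u; rewrite // e.
Qed.

Lemma equivl_trans : transitive equivl.
Proof.
move=> y x z /equivlP[u uS eu] /equivlP[v vS ev]; apply/equivlP.
exists (u * v * den y); first by rewrite !rpredM ?den_in.
transitivity (v * den z * (u * (num x * den y))); first by ring.
rewrite eu; transitivity (u * den x * (v * (num y * den z))); first by ring.
by rewrite ev; ring.
Qed.

Canonical equivl_equiv := EquivRel equivl equivl_refl equivl_sym equivl_trans.

Definition type := {eq_quot equivl}.

HB.instance Definition _ : EqQuotient _ equivl type := EqQuotient.on type.
HB.instance Definition _ := Choice.on type.

Lemma equivl_repr x :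
  exists2 u, u \in S &
    u * (num (repr (\pi_type x)) * den x) =
    u * (num x * den (repr (\pi_type x))).
Proof.
have /eqP := reprK (\pi_type x).
by rewrite eqmodE => /equivlP.
Qed.

Definition fracl (a : A) : ratio := Ratio a (rpred1 S).
Definition addf x y : ratio :=
  Ratio (num x * den y + num y * den x) (rpredM (den_in x) (den_in y)).
Definition oppf x : ratio := Ratio (- num x) (den_in x).
Definition mulf x y : ratio :=
  Ratio (num x * num y) (rpredM (den_in x) (den_in y)).

Definition to_loc := lift_embed type fracl.
Canonical to_loc_pi_morph := PiEmbed to_loc.

Definition add := lift_op2 type addf.
Lemma pi_add : {morph \pi : x y / addf x y >-> add x y}.
Proof.
move=> x y; unlock add; apply/eqmodP/equivlP => /=.
have [u uS eu] := equivl_repr x; have [v vS ev] := equivl_repr y.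
exists (u * v); first by rewrite rpredM.
set x' := repr _ in eu *; set y' := repr _ in ev *.
transitivity (v * den y * den y' * (u * (num x * den x')) +
              u * den x * den x' * (v * (num y * den y'))); first by ring.
by rewrite -eu -ev; ring.
Qed.
Canonical pi_add_morph := PiMorph2 pi_add.

Definition opp := lift_op1 type oppf.
Lemma pi_opp : {morph \pi : x / oppf x >-> opp x}.
Proof.
move=> x; unlock opp; apply/eqmodP/equivlP => /=.
by have [u uS eu] := equivl_repr x; exists u; rewrite // !mulNr !mulrN eu.
Qed.
Canonical pi_opp_morph := PiMorph1 pi_opp.

Definition mul := lift_op2 type mulf.
Lemma pi_mul : {morph \pi : x y / mulf x y >-> mul x y}.
Proof.
move=> x y; unlock mul; apply/eqmodP/equivlP => /=.
have [u uS eu] := equivl_repr x; have [v vS ev] := equivl_repr y.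
exists (u * v); first by rewrite rpredM.
set x' := repr _ in eu *; set y' := repr _ in ev *.
transitivity ((u * (num x * den x')) * (v * (num y * den y'))); first by ring.
by rewrite -eu -ev; ring.
Qed.
Canonical pi_mul_morph := PiMorph2 pi_mul.

Lemma eq_pi x y : num x * den y = num y * den x -> \pi_type x = \pi_type y.
Proof.
by move=> e; apply/eqmodP/equivlP; exists 1; rewrite ?rpred1 ?e.
Qed.

Lemma addA : associative add.
Proof.
elim/quotW=> x; elim/quotW=> y; elim/quotW=> z; rewrite !piE.
by apply: eq_pi => /=; ring.
Qed.

Lemma addC : commutative add.
Proof.
by elim/quotW=> x; elim/quotW=> y; rewrite !piE; apply: eq_pi => /=; ring.
Qed.

Lemma add0 : left_id (to_loc 0) add.
Proof. by elim/quotW=> x; rewrite !piE; apply: eq_pi => /=; ring. Qed.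

Lemma addN : left_inverse (to_loc 0) opp add.
Proof. by elim/quotW=> x; rewrite !piE; apply: eq_pi => /=; ring. Qed.

HB.instance Definition _ := GRing.isZmodule.Build type addA addC add0 addN.

Lemma mulA : associative mul.
Proof.
elim/quotW=> x; elim/quotW=> y; elim/quotW=> z; rewrite !piE.
by apply: eq_pi => /=; ring.
Qed.

Lemma mulC : commutative mul.
Proof.
by elim/quotW=> x; elim/quotW=> y; rewrite !piE; apply: eq_pi => /=; ring.
Qed.

Lemma mul1 : left_id (to_loc 1) mul.
Proof. by elim/quotW=> x; rewrite !piE; apply: eq_pi => /=; ring. Qed.

Lemma mulD : left_distributive mul add.
Proof.
elim/quotW=> x; elim/quotW=> y; elim/quotW=> z; rewrite !piE.
by apply: eq_pi => /=; ring.
Qed.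

HB.instance Definition _ :=
  GRing.Zmodule_isComPzRing.Build type mulA mulC mul1 mulD.

Lemma to_loc_is_zmod_morphism : zmod_morphism to_loc.
Proof.
move=> a b; unlock to_loc.
rewrite -[X in _ = _ + X]pi_opp -[RHS]pi_add.
by apply: eq_pi => /=; ring.
Qed.

HB.instance Definition _ :=
  GRing.isZmodMorphism.Build A type to_loc to_loc_is_zmod_morphism.

Lemma to_loc_is_monoid_morphism : monoid_morphism to_loc.
Proof.
split=> // a b; unlock to_loc; rewrite -[RHS]pi_mul.
by apply: eq_pi => /=; ring.
Qed.

HB.instance Definition _ :=
  GRing.isMonoidMorphism.Build A type to_loc to_loc_is_monoid_morphism.

Lemma to_loc_unit s : s \in S -> exists y : type, to_loc s * y = 1.
Proof.
move=> sS; exists (\pi_type (Ratio 1 sS)).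
change (mul (to_loc s) (\pi_type (Ratio 1 sS)) = to_loc 1).
by rewrite !piE; apply: eq_pi => /=; ring.
Qed.

Lemma to_loc_eq a b :
  to_loc a = to_loc b <-> exists2 u, u \in S & u * a = u * b.
Proof.
unlock to_loc; split=> [/eqmodP/equivlP[u uS]|[u uS e]].
  by rewrite /= !mulr1; exists u.
by apply/eqmodP/equivlP; exists u; rewrite //= !mulr1.
Qed.

Lemma to_loc_surj (z : type) :
  exists a s, s \in S /\ z * to_loc s = to_loc a.
Proof.
elim/quotW: z => x; exists (num x), (den x); split; first exact: den_in.
change (mul (\pi_type x) (to_loc (den x)) = to_loc (num x)).
by rewrite !piE; apply: eq_pi => /=; ring.
Qed.

End Localization.
End Localization.
HB.export Localization.

Notation localization := Localization.type.
Notation to_loc := Localization.to_loc.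

Definition powers (A : comPzRingType) (x : A) : {pred A} :=
  [pred y | `[< exists n : nat, y = x ^+ n >]].

Lemma powers_mulr_closed (A : comPzRingType) (x : A) : mulr_closed (powers x).
Proof.
split=> [|_ _ /asboolP[m ->] /asboolP[n ->]]; apply/asboolP.
  by exists 0%N; rewrite expr0.
by exists (m + n)%N; rewrite exprD.
Qed.

HB.instance Definition _ (A : comPzRingType) (x : A) :=
  GRing.isMulClosed.Build A (powers x) (powers_mulr_closed x).

Section PowerSeries.
Variable R : comNzRingType.

Record powerseries := PowerSeries { pscoef : nat -> R }.
Implicit Types f g h : powerseries.

HB.instance Definition _ := gen_eqMixin powerseries.
HB.instance Definition _ := gen_choiceMixin powerseries.

Lemma powerseriesP f g : pscoef f =1 pscoef g -> f = g.
Proof. by case: f g => [f] [g] /= /funext ->. Qed.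

Definition ps0 := PowerSeries (fun=> 0).
Definition ps1 := PowerSeries (fun n => (n == 0)%:R).
Definition psadd f g := PowerSeries (fun n => pscoef f n + pscoef g n).
Definition psopp f := PowerSeries (fun n => - pscoef f n).
Definition psmul f g :=
  PowerSeries (fun n => \sum_(i < n.+1) pscoef f i * pscoef g (n - i)).

Lemma psaddA : associative psadd.
Proof. by move=> f g h; apply: powerseriesP => n /=; rewrite addrA. Qed.

Lemma psaddC : commutative psadd.
Proof. by move=> f g; apply: powerseriesP => n /=; rewrite addrC. Qed.

Lemma psadd0 : left_id ps0 psadd.
Proof. by move=> f; apply: powerseriesP => n /=; rewrite add0r. Qed.

Lemma psaddN : left_inverse ps0 psopp psadd.
Proof. by move=> f; apply: powerseriesP => n /=; rewrite addNr. Qed.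

HB.instance Definition _ :=
  GRing.isZmodule.Build powerseries psaddA psaddC psadd0 psaddN.

(* The ring axioms reduce to those of [{poly R}]: the coefficients of a product
   up to degree [n] depend only on the truncations at degree [n]. *)
Let trunc n f : {poly R} := \poly_(i < n.+1) pscoef f i.

Let pscoef_mul n k f g :
  (k <= n)%N -> pscoef (psmul f g) k = (trunc n f * trunc n g)`_k.
Proof.
move=> le_kn; rewrite coefM; apply: eq_bigr => i _.
rewrite !coef_poly !ltnS (leq_trans _ le_kn) ?leq_ord //.
by rewrite (leq_trans (leq_subr _ _) le_kn).
Qed.

Lemma psmulC : commutative psmul.
Proof.
by move=> f g; apply: powerseriesP => n; rewrite !(@pscoef_mul n) // mulrC.
Qed.

Lemma psmulA : associative psmul.
Proof.
move=> f g h; apply: powerseriesP => n.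
transitivity (trunc n f * (trunc n g * trunc n h))`_n.
  rewrite coefM; apply: eq_bigr => i _.
  rewrite coef_poly ltn_ord; congr (_ * _).
  by rewrite (@pscoef_mul n) // leq_subr.
rewrite mulrA coefM; apply: eq_bigr => i _.
rewrite coef_poly ltnS leq_subr; congr (_ * _).
by rewrite (@pscoef_mul n) // leq_ord.
Qed.

Lemma psmul1 : left_id ps1 psmul.
Proof.
move=> f; apply: powerseriesP => n /=.
rewrite big_ord_recl /= mul1r subn0 big1 ?addr0 // => i _.
by rewrite mul0r.
Qed.

Lemma psmulD : left_distributive psmul psadd.
Proof.
move=> f g h; apply: powerseriesP => n /=.
by rewrite -big_split; apply: eq_bigr => i _; rewrite mulrDl.
Qed.

Lemma ps1_neq0 : ps1 != ps0.
Proof.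
by apply/eqP => /(congr1 (fun f => pscoef f 0)) /eqP; rewrite /= oner_eq0.
Qed.

HB.instance Definition _ := GRing.Zmodule_isComNzRing.Build powerseries
  psmulA psmulC psmul1 psmulD ps1_neq0.

Definition psX : powerseries := PowerSeries (fun n => (n == 1)%:R).

End PowerSeries.

Definition laurent_poly (R : comNzRingType) : comPzRingType :=
  localization (powers ('X : {poly R})).

Definition monic_localization (R : comNzRingType) : comPzRingType :=
  localization (@monic_pred R : {pred {poly R}}).

Definition laurent_series (R : comNzRingType) : comPzRingType :=
  localization (powers (psX R)).

(* Main.v *)
(* A ring is Hermite when every unimodular row over it is the first row of an
   invertible matrix. With [s] the inverse of [t], the ring [R<t>] is the
   localization of [R[s]] at the polynomials with lowest coefficient 1, which is
   [s]-adically dense in [R((s))]; truncating power series gives (iii) <-> (iv).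

   A unimodular row over [R((t))] may be changed modulo a high power of [t] and,
   by elementary operations lifted from the residue field, is [(t^e, 0, ..., 0)]
   modulo the maximal ideal. Adding suitable high powers of [t] to its first two
   entries makes the row polynomial, unimodular over [R[t, 1/t]] by Nakayama's
   lemma, and monic of maximal degree in its first entry, so that it becomes
   unimodular over [R[1/t]]. Hence each of (i) and (ii) implies (iv).

   Conversely let [v] be a unimodular row over [R[1/t]] or [R[t, 1/t]] that is
   the first row of [G] in [GL_n(R((t)))]. Division of polynomials over the
   residue field allows one to assume that [v] and [G] are trivial modulo the
   maximal ideal. Then [G = U * Gam] with [U] in [GL_n(R[[t]])] and [Gam] in
   [GL_n(R[1/t])]: this is Horrocks' theorem in the form of a Weierstrass
   preparation of the matrix [t^N G]. So [v] may be replaced by the first row of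
   [U]. If [v] is over [R[1/t]], this row is constant, which gives (iv) -> (i).
   If [v] is over [R[t, 1/t]], it is unimodular over [R[t]], and (i) applies. *)
From HB Require Import structures.
Require Import Defs.
From mathcomp Require Import all_boot all_algebra.
From mathcomp Require Import perm boolp classical_sets.
From mathcomp Require Import zify ring.

Set Implicit Arguments.
Unset Strict Implicit.
Unset Printing Implicit Defensive.

Import GRing.Theory.
Local Open Scope ring_scope.
Local Open Scope quotient_scope.

(** * The residue field *)

Lemma local_ring_nonunit (R : comNzRingType) (m : {pred R}) :
  (forall m' : {pred R}, maximal_ideal m' -> m' =i m) ->
  forall x : R, x \notin m -> exists y, x * y = 1.
Proof.
move=> uniq_m x xNm; apply: contrapT => Nux.
pose P (A : set R) := [/\ forall u v, A u -> A v -> A (u - v),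
  forall a u, A u -> A (a * u), ~ A 1 & forall u, A u -> A x].
have [A [[AB AM A1 Ax] Amax]] : exists A, P A /\ forall B, (A `<` B)%classic
  -> ~ P B.
  apply: Zorn_bigcup => F FP tot; split.
  - move=> u v [X FX Xu] [Y FY Yv].
    have [XB _ _ _] := FP _ FX; have [YB _ _ _] := FP _ FY.
    have [sXY|sYX] := tot _ _ FX FY.
      by exists Y => //; apply: YB => //; apply: sXY.
    by exists X => //; apply: XB => //; apply: sYX.
  - move=> a u [X FX Xu]; exists X => //.
    by have [_ XM _ _] := FP _ FX; apply: XM.
  - by move=> [X FX X1]; have [_ _ + _] := FP _ FX.
  - move=> u [X FX Xu]; exists X => //.
    by have [_ _ _ Xx] := FP _ FX; apply: Xx Xu.
have {}Ax : A x.
  apply: contrapT => NAx; have A0 u : ~ A u by move=> /Ax.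
  apply: (Amax [set u | exists a, u = a * x]%classic).
    split; first by move=> u /A0.
    by move=> /(_ x) sub; apply: NAx; apply: sub; exists 1; rewrite mul1r.
  split => [_ _ [a ->] [b ->]|a _ [b ->]|[a e]|_ _].
  - by exists (a - b); rewrite mulrBl.
  - by exists (a * b); rewrite mulrA.
  - by apply: Nux; exists a; rewrite mulrC -e.
  - by exists 1; rewrite mul1r.
pose m' : {pred R} := [pred u | `[< A u >]].
have A0 : A 0 by rewrite -(subrr x); apply: AB.
have AN v : A v -> A (- v) by move=> Av; rewrite -sub0r; apply: (AB).
have : maximal_ideal m'.
  split.
    split; [by apply/asboolP|by apply/negP => /asboolP|].
    move=> a u v /asboolP Au /asboolP Av; apply/asboolP.
    by rewrite -[v]opprK; apply: AB; [apply: (AM)|apply: AN].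
  move=> J [J0 /negP J1 JD] sub u uJ; apply: contrapT => Nu.
  apply: (Amax [set u | u \in J]%classic).
    split; first by move=> v Av; apply: sub; apply/asboolP.
    by move=> /(_ u uJ) Au; apply: Nu; apply/asboolP.
  split=> // [v w vJ wJ|a v vJ|v vJ].
  - by rewrite addrC -mulN1r; apply: JD.
  - by rewrite -[_ * _]addr0; apply: JD.
  - by apply: sub; apply/asboolP.
move=> /uniq_m /(_ x) e; move: xNm; rewrite -e => /negP; apply.
exact/asboolP.
Qed.

Lemma local_residue_field (R : comNzRingType) : local_ring R ->
  exists (k : fieldType) (f : {rmorphism R -> k}),
    (forall y, exists x, f x = y) /\
    (forall x, f x != 0 -> exists y, x * y = 1).
Proof.
move=> [m [idm _] /local_ring_nonunit unit_m].
pose mI := isIdealr.Build R m idm.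
pose I : idealr R := HB.pack m mI.
pose Q : comNzRingType := {ideal_quot I}.
have pi0 (x : R) : (\pi_Q x == 0 :> Q) = (x \in I).
  by rewrite -[x in RHS]subr0 Quotient.idealrBE !piE.
have pi_surj (y : Q) : exists x, \pi_Q x = y by exists (repr y); rewrite reprK.
have invP (y : Q) : exists z : Q, (y != 0 -> z * y = 1) /\ (y == 0 -> z = 0).
  have [x <-] := pi_surj y; have [xI|xI] := boolP (x \in I).
    by exists 0; rewrite pi0 xI.
  have [z xz] := unit_m x xI; exists (\pi_Q z); rewrite pi0 (negPf xI).
  by split=> // _; rewrite -rmorphM mulrC xz rmorph1.
pose inv (y : Q) := projT1 (cid (invP y)).
have mulV : forall y : Q, y != 0 -> inv y * y = 1.
  by move=> y y0; rewrite /inv; case: cid => z /= [+ _]; apply.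
have inv0 : inv 0 = 0 by rewrite /inv; case: cid => z /= [_]; apply.
pose fQ := GRing.ComNzRing_isField.Build Q mulV inv0.
pose k : fieldType := HB.pack Q fQ.
exists k, (\pi_Q : {rmorphism R -> Q}); split=> [//|x].
by rewrite pi0; apply: unit_m.
Qed.

(** * Unimodular rows *)

Lemma mulmx_scalarC (A : comPzRingType) n (G H : 'M[A]_n) (s : A) :
  GRing.lreg s -> G *m H = s%:M -> H *m G = s%:M.
Proof.
move=> reg_s GH; pose X := H *m G - s%:M.
have GX : G *m X = 0.
  by rewrite mulmxBr mulmxA GH mul_scalar_mx mul_mx_scalar subrr.
have dGX : \det G *: X = 0.
  by rewrite -mul_scalar_mx -mul_adj_mx -mulmxA GX mulmx0.
have snX : s ^+ n *: X = 0.
  by rewrite -det_scalar -GH det_mulmx mulrC -scalerA dGX scaler0.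
apply/eqP; rewrite -subr_eq0; apply/eqP/matrixP=> i j; rewrite [RHS]mxE.
apply: (GRing.lregX (n := n) reg_s); rewrite mulr0.
by have /matrixP/(_ i j) := snX; rewrite [LHS]mxE [RHS]mxE.
Qed.

Lemma scalar_mx_inj (A : comPzRingType) n (s : A) m (X Y : 'M[A]_(m, n)) :
  GRing.lreg s -> s *: X = s *: Y -> X = Y.
Proof.
move=> reg_s e; apply/matrixP=> i j; apply: reg_s.
by have /matrixP/(_ i j) := e; rewrite !mxE.
Qed.

Lemma map_scalemx (A B : pzRingType) (f : {rmorphism A -> B}) m n (a : A)
  (X : 'M_(m, n)) : map_mx f (a *: X) = f a *: map_mx f X.
Proof. by apply/matrixP=> i j; rewrite !mxE rmorphM. Qed.

Lemma mx_inv_lift (A B : comPzRingType) (f : {rmorphism A -> B}) :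
  (forall x, f x = 1 -> exists y, x * y = 1) ->
  forall n (X : 'M[A]_n), map_mx f X = 1%:M -> exists Y, X *m Y = 1%:M.
Proof.
move=> unit_f n X fX; have [|u du] := unit_f (\det X).
  by rewrite -det_map_mx fX det1.
by exists (u *: \adj X); rewrite -scalemxAr mul_mx_adj scale_scalar_mx mulrC du.
Qed.

Section UnimodularRows.
Variables (A : comPzRingType) (S : mulrClosed A).

(* For a set [S] of regular elements these notions are, after clearing
   denominators, those of the rows of the localization at [S]: a row is
   completable when it is the first row of an invertible matrix. *)
Definition unimodular n (v : 'rV[A]_n.+1) : Prop :=
  exists2 s, s \in S & exists w : 'cV_n.+1, v *m w = s%:M.

Definition completable n (v : 'rV[A]_n.+1) : Prop :=
  exists (G H : 'M[A]_n.+1) (s c : A),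
    [/\ s \in S, c \in S, G *m H = s%:M & row ord0 G = c *: v].

Definition rows_completable : Prop :=
  forall n (v : 'rV[A]_n.+1), unimodular v -> completable v.

Lemma completable_mul n (v : 'rV[A]_n.+1) (T T' : 'M_n.+1) t :
  GRing.lreg t -> t \in S -> T *m T' = t%:M ->
  completable (v *m T) -> completable v.
Proof.
move=> reg_t tS TT' [G [H [s [c [sS cS GH G0]]]]].
exists (G *m T'), (T *m H), (t * s), (c * t); split; rewrite ?rpredM //.
  rewrite mulmxA -(mulmxA G) (mulmx_scalarC reg_t TT') mul_mx_scalar.
  by rewrite -scalemxAl GH scale_scalar_mx.
by rewrite row_mul G0 -scalemxAl -mulmxA TT' mul_mx_scalar scalerA.
Qed.

Lemma completable_scale n (v : 'rV[A]_n.+1) c :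
  c \in S -> completable (c *: v) -> completable v.
Proof.
move=> cS [G [H [s [d [sS dS GH G0]]]]].
by exists G, H, s, (d * c); rewrite G0 scalerA rpredM.
Qed.

Lemma completable1 (v : 'rV[A]_1) : unimodular v -> completable v.
Proof.
move=> [s sS [w vw]]; exists v, w, s, 1; rewrite rpred1 scale1r; split=> //.
by apply/rowP=> i; rewrite mxE.
Qed.

Lemma unimodular_mul n (v : 'rV[A]_n.+1) (T T' : 'M_n.+1) t :
  t \in S -> T *m T' = t%:M -> unimodular v -> unimodular (v *m T).
Proof.
move=> tS TT' [s sS [w vw]]; exists (t * s); first by rewrite rpredM.
exists (T' *m w); rewrite mulmxA -(mulmxA v) TT' mul_mx_scalar.
by rewrite -scalemxAl vw scale_scalar_mx.
Qed.

End UnimodularRows.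

Lemma unimodular_map (A B : comPzRingType) (f : {rmorphism A -> B})
    (S : mulrClosed A) (S' : mulrClosed B) n (v : 'rV[A]_n.+1) :
  (forall s, s \in S -> f s \in S') ->
  unimodular S v -> unimodular S' (map_mx f v).
Proof.
move=> fS [s sS [w vw]]; exists (f s); first exact: fS.
by exists (map_mx f w); rewrite -map_mxM vw map_scalar_mx.
Qed.

Lemma completable_map (A B : comPzRingType) (f : {rmorphism A -> B})
    (S : mulrClosed A) (S' : mulrClosed B) n (v : 'rV[A]_n.+1) :
  (forall s, s \in S -> f s \in S') ->
  completable S v -> completable S' (map_mx f v).
Proof.
move=> fS [G [H [s [c [sS cS GH G0]]]]].
exists (map_mx f G), (map_mx f H), (f s), (f c).
split; [exact: fS|exact: fS|by rewrite -map_mxM GH map_scalar_mx|].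
by rewrite -map_row G0 map_scalemx.
Qed.

Lemma powers1 (A : comPzRingType) (x : A) : (x \in powers 1) = (x == 1).
Proof.
apply/asboolP/eqP => [[n ->]|->]; first by rewrite expr1n.
by exists 0.
Qed.

Lemma powersX (A : comPzRingType) (x : A) n : x ^+ n \in powers x.
Proof. by apply/asboolP; exists n. Qed.

Lemma powersP (A : comPzRingType) (x y : A) :
  reflect (exists n, y = x ^+ n) (y \in powers x).
Proof. exact: asboolP. Qed.

(** * Power series *)

Section PowerSeriesTheory.
Variable R : comNzRingType.
Local Notation ps := (powerseries R).
Local Notation t := (psX R).

Lemma pscoefD (f g : ps) n : pscoef (f + g) n = pscoef f n + pscoef g n.
Proof. by []. Qed.

Lemma pscoefN (f : ps) n : pscoef (- f) n = - pscoef f n.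
Proof. by []. Qed.

Lemma pscoefM (f g : ps) n :
  pscoef (f * g) n = \sum_(i < n.+1) pscoef f i * pscoef g (n - i).
Proof. by []. Qed.

Definition ps_of_poly (p : {poly R}) : ps := PowerSeries (fun n => p`_n).

Lemma ps_of_poly_is_zmod_morphism : zmod_morphism ps_of_poly.
Proof. by move=> p q; apply: powerseriesP => n; rewrite /= coefB. Qed.

HB.instance Definition _ :=
  GRing.isZmodMorphism.Build _ _ ps_of_poly ps_of_poly_is_zmod_morphism.

Lemma ps_of_poly_is_monoid_morphism : monoid_morphism ps_of_poly.
Proof.
split; first by apply: powerseriesP => n; rewrite /= coef1.
by move=> p q; apply: powerseriesP => n; rewrite /= coefM.
Qed.

HB.instance Definition _ :=
  GRing.isMonoidMorphism.Build _ _ ps_of_poly ps_of_poly_is_monoid_morphism.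

Lemma ps_of_polyX : ps_of_poly 'X = t.
Proof. by apply: powerseriesP => n; rewrite /= coefX. Qed.

Lemma ps_of_polyXn n : ps_of_poly 'X^n = t ^+ n.
Proof. by rewrite rmorphXn /= ps_of_polyX. Qed.

Lemma ps_of_poly_inj : injective ps_of_poly.
Proof. by move=> p q e; apply/polyP => n;
  have := congr1 (fun f => pscoef f n) e. Qed.

Lemma pscoefXnM m (f : ps) n :
  pscoef (t ^+ m * f) n = if (n < m)%N then 0 else pscoef f (n - m).
Proof.
rewrite -ps_of_polyXn pscoefM.
under eq_bigr do rewrite /= coefXn.
case: ltnP => [lt_nm|le_mn].
  apply: big1 => i _; rewrite [_ == m]ltn_eqF ?mulr0n ?mul0r //.
  exact: leq_ltn_trans (leq_ord i) lt_nm.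
rewrite (bigD1 (inord m)) //= inordK ?ltnS // eqxx mulr1n mul1r big1 ?addr0 //
  => i ne.
rewrite [_ == m](introF eqP) ?mulr0n ?mul0r // => e.
by move/eqP: ne; apply; apply: val_inj; rewrite /= inordK ?ltnS.
Qed.

Lemma psXn_lreg m : GRing.lreg (t ^+ m).
Proof.
move=> f g e; apply: powerseriesP => n.
have : pscoef (t ^+ m * f) (m + n) = pscoef (t ^+ m * g) (m + n) by rewrite e.
by rewrite !pscoefXnM ltnNge leq_addr addKn.
Qed.

Definition pstrunc m (f : ps) : {poly R} := \poly_(i < m) pscoef f i.
Definition psdrop m (f : ps) : ps := PowerSeries (fun n => pscoef f (m + n)).

Lemma pstruncK m (f : ps) :
  f = ps_of_poly (pstrunc m f) + t ^+ m * psdrop m f.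
Proof.
apply: powerseriesP => n; rewrite pscoefD pscoefXnM /= coef_poly.
by case: ltnP => le; rewrite ?addr0 // add0r subnKC.
Qed.

Definition psconst (f : ps) : R := pscoef f 0.

Lemma psconst_is_zmod_morphism : zmod_morphism psconst.
Proof. by []. Qed.

HB.instance Definition _ :=
  GRing.isZmodMorphism.Build _ _ psconst psconst_is_zmod_morphism.

Lemma psconst_is_monoid_morphism : monoid_morphism psconst.
Proof.
by split=> // f g; rewrite /psconst pscoefM big_ord_recl big_ord0 addr0.
Qed.

HB.instance Definition _ :=
  GRing.isMonoidMorphism.Build _ _ psconst psconst_is_monoid_morphism.

Lemma psconstX : psconst t = 0.
Proof. by []. Qed.

Lemma pscoef_exp_lt (h : ps) n i :
  psconst h = 0 -> (i < n)%N -> pscoef (h ^+ n) i = 0.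
Proof.
move=> h0; have -> : h = t * psdrop 1 h.
  rewrite [LHS](pstruncK 1) expr1; set p := pstrunc 1 h.
  suff -> : p = 0 by rewrite rmorph0 add0r.
  by apply/polyP => j; rewrite coef_poly coef0; case: j.
by move=> lt_in; rewrite exprMn pscoefXnM lt_in.
Qed.

Lemma psunit1 (f : ps) : psconst f = 1 -> exists g, f * g = 1.
Proof.
move=> f1; pose h := 1 - f.
have h0 : psconst h = 0 by rewrite rmorphB rmorph1 /= f1 subrr.
pose G n := \sum_(j < n) h ^+ j.
exists (PowerSeries (fun n => pscoef (G n.+1) n)).
have Gstable n i : (i < n)%N -> pscoef (G n) i = pscoef (G i.+1) i.
  elim: n => // n IHn; rewrite ltnS leq_eqVlt => /predU1P[-> //|lt_in].
  rewrite -IHn // {1}/G big_ord_recr pscoefD pscoef_exp_lt ?addr0 //.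
apply: powerseriesP => n; transitivity (pscoef (f * G n.+1) n).
  apply: eq_bigr => i _ /=; congr (_ * _).
  by rewrite Gstable // ltnS leq_subr.
have -> : f * G n.+1 = 1 - h ^+ n.+1.
  by rewrite -[RHS]opprB subrX1 -mulNr opprB opprB addrC subrK.
by rewrite pscoefD pscoefN pscoef_exp_lt // subr0.
Qed.

Lemma psunit (f : ps) :
  (exists c, psconst f * c = 1) -> exists g, f * g = 1.
Proof.
move=> [c fc]; have [|g fg] := @psunit1 (f * ps_of_poly c%:P).
  by rewrite rmorphM /= -fc {2}/psconst /= coefC.
by exists (ps_of_poly c%:P * g); rewrite mulrA.
Qed.

End PowerSeriesTheory.

Section PowerSeriesMap.
Variables (R k : comNzRingType) (f : {rmorphism R -> k}).

Definition psmap (g : powerseries R) : powerseries k :=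
  PowerSeries (fun n => f (pscoef g n)).

Lemma psmap_is_zmod_morphism : zmod_morphism psmap.
Proof. by move=> g h; apply: powerseriesP => n; rewrite /= rmorphB. Qed.

HB.instance Definition _ :=
  GRing.isZmodMorphism.Build _ _ psmap psmap_is_zmod_morphism.

Lemma psmap_is_monoid_morphism : monoid_morphism psmap.
Proof.
split; first by apply: powerseriesP => n; rewrite /= rmorph_nat.
move=> g h; apply: powerseriesP => n; rewrite /= rmorph_sum.
by apply: eq_bigr => i _; rewrite rmorphM.
Qed.

HB.instance Definition _ :=
  GRing.isMonoidMorphism.Build _ _ psmap psmap_is_monoid_morphism.

Lemma psmapX : psmap (psX R) = psX k.
Proof. by apply: powerseriesP => n; rewrite /= rmorph_nat. Qed.

Lemma psmapXn n : psmap (psX R ^+ n) = psX k ^+ n.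
Proof. by rewrite rmorphXn /= psmapX. Qed.

Lemma psmapXnM n g : psmap (psX R ^+ n * g) = psX k ^+ n * psmap g.
Proof. by rewrite rmorphM rmorphXn /= psmapX. Qed.

Lemma psmap_ps_of_poly p : psmap (ps_of_poly p) = ps_of_poly (map_poly f p).
Proof. by apply: powerseriesP => n; rewrite /= coef_map. Qed.

End PowerSeriesMap.

(** * Weierstrass preparation for matrices *)

Definition deg_le (R : nzRingType) m n (d : nat) (X : 'M[{poly R}]_(m, n)) :=
  forall i j, (size (X i j) <= d.+1)%N.

Lemma deg_le_mulmx (R : nzRingType) m n p (d e : nat)
    (X : 'M[{poly R}]_(m, n)) (Y : 'M_(n, p)) :
  deg_le d X -> deg_le e Y -> deg_le (d + e) (X *m Y).
Proof.
move=> dX eY i j; rewrite mxE.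
apply: (leq_trans (size_sum _ _ _)); apply/bigmax_leqP => l _.
apply: (leq_trans (size_polyMleq _ _)); rewrite -subn1 leq_subLR.
by apply: leq_trans (leq_add (dX i l) (eY l j)) _; rewrite addSn addnS.
Qed.

Lemma nakayama (R k : comNzRingType) (f : {rmorphism R -> k})
    (unit_f : forall x, f x = 1 -> exists y, x * y = 1)
    (A : comPzRingType) (io : {rmorphism R -> A}) (V : lmodType A)
    (N : V -> Prop) (N0 : N 0) (ND : forall x y, N x -> N y -> N (x + y))
    (NZ : forall c x, N x -> N (io c *: x))
    (I : finType) (b : I -> V) (X : I -> I -> R) :
  (forall i j, f (X i j) = (i == j)%:R) ->
  (forall i, N (\sum_j io (X i j) *: b j)) -> forall i, N (b i).
Proof.
move=> fX NX i; pose M := \matrix_(l, j < #|I|) X (enum_val l) (enum_val j).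
have [|Y /mulmx1C YM] := mx_inv_lift unit_f (X := M).
  by apply/matrixP=> l j; rewrite !mxE fX (inj_eq enum_val_inj).
have -> : b i = \sum_l io (Y (enum_rank i) (enum_rank l)) *:
                  \sum_j io (X l j) *: b j.
  have E j : \sum_l io (Y (enum_rank i) (enum_rank l)) *: (io (X l j) *: b j)
             = (i == j)%:R *: b j.
    under eq_bigr do rewrite scalerA -rmorphM.
    rewrite -scaler_suml -rmorph_sum.
    have /matrixP/(_ (enum_rank i) (enum_rank j)) := YM.
    rewrite !mxE (inj_eq enum_rank_inj).
    rewrite (reindex enum_rank) /=; last exact/onW_bij/enum_rank_bij.
    by under eq_bigr do rewrite mxE !enum_rankK; move=> ->; rewrite rmorph_nat.
  under eq_bigr do rewrite scaler_sumr.
  rewrite exchange_big; under eq_bigr do rewrite E.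
  rewrite (bigD1 i) //= eqxx scale1r big1 ?addr0 // => j ne_ji.
  by rewrite eq_sym (negPf ne_ji) scale0r.
by elim/big_ind: _ => // l _; apply: NZ.
Qed.

Section Weierstrass.
Variables (R k : comNzRingType) (f : {rmorphism R -> k}).
Hypothesis unit_f : forall x, f x = 1 -> exists y, x * y = 1.
Local Notation ps := (powerseries R).
Local Notation t := (psX R).
Local Notation ofp := (@ps_of_poly R).
Let io : {rmorphism R -> ps} := ofp \o polyC.

Lemma pssplit N K (g : ps) : (N <= K)%N ->
  g = ofp (pstrunc N g)
      + (\sum_(j < K - N) io (pscoef g (N + j)) * t ^+ (N + j))
      + t ^+ K * psdrop K g.
Proof.
move=> le_NK; rewrite [LHS](pstruncK K); congr (_ + _).
transitivity (ofp (pstrunc N g +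
    \sum_(j < K - N) (pscoef g (N + j))%:P * 'X^(N + j))); last first.
  rewrite rmorphD rmorph_sum /=; congr (_ + _); apply: eq_bigr => j _.
  by rewrite rmorphM /= ps_of_polyXn.
congr (ofp _); apply/polyP => n; rewrite coefD coef_sum !coef_poly.
under eq_bigr do rewrite coefCM coefXn.
case: (ltnP n N) => [lt_nN|le_Nn].
  rewrite (leq_trans lt_nN le_NK) big1 ?addr0 // => j _.
  by rewrite [_ == _](introF eqP) ?mulr0 // => e; move: lt_nN;
    rewrite e ltnNge leq_addr.
case: (ltnP n K) => [lt_nK|le_Kn].
  have lt' : (n - N < K - N)%N by rewrite ltn_sub2r // (leq_ltn_trans le_Nn).
  rewrite (bigD1 (Ordinal lt')) //= subnKC // eqxx mulr1 big1 ?addr0 ?add0r //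
    => j.
  move=> /eqP ne; rewrite [_ == _](introF eqP) ?mulr0 // => e.
  by apply: ne; apply: val_inj; rewrite /= e addKn.
rewrite big1 ?addr0 // => j _; rewrite [_ == _](introF eqP) ?mulr0 // => e.
by have := ltn_ord j; lia.
Qed.

Lemma psrow_split n N K (x : 'rV[ps]_n) : (N <= K)%N ->
  x = map_mx ofp (map_mx (pstrunc N) x)
      + (\sum_(p : 'I_n * 'I_(K - N)) io (pscoef (x 0 p.1) (N + p.2)) *:
           (t ^+ (N + p.2) *: delta_mx 0 p.1))
      + t ^+ K *: map_mx (psdrop K) x.
Proof.
move=> le_NK; apply/rowP => i; rewrite !mxE summxE.
rewrite [LHS](pssplit _ le_NK); congr (_ + _ + _).
rewrite -(pair_bigA _ (fun (i' : 'I_n) (j : 'I_(K - N))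
  => (io (pscoef (x 0 i') (N + j)) *:
           (t ^+ (N + j) *: delta_mx 0 i') : 'rV[ps]_n) 0 i)) /=.
rewrite (bigD1 i) //= [X in _ = _ + X]big1 ?addr0 => [|i' ne]; last first.
  by apply: big1 => j _; rewrite !mxE eq_sym (negPf ne) andbF !mulr0.
by apply: eq_bigr => j _; rewrite !mxE !eqxx mulr1.
Qed.

(* [R] is not complete, but since [H *m G] is a power of [t] the cokernel of [G]
   is finitely generated over [R], so that Nakayama's lemma applies. *)
Lemma weierstrass_division n (G H : 'M[ps]_n) K N : (N <= K)%N ->
  H *m G = (t ^+ K)%:M -> map_mx (psmap f) G = (psX k ^+ N)%:M ->
  forall x : 'rV_n, exists (y : 'rV_n) (r : 'rV[{poly R}]_n),
    x = y *m G + map_mx ofp r /\ forall i j, (size (r i j) <= N)%N.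
Proof.
move=> le_NK HG fG.
pose D (x : 'rV_n) := exists (y : 'rV_n) (r : 'rV[{poly R}]_n),
    x = y *m G + map_mx ofp r /\ forall i j, (size (r i j) <= N)%N.
have D0 : D 0.
  by exists 0, 0; rewrite mul0mx map_mx0 addr0; split=> // i j;
    rewrite mxE size_poly0.
have DD x y : D x -> D y -> D (x + y).
  move=> [u [r [-> ru]]] [v [s [-> sv]]]; exists (u + v), (r + s); split.
    by rewrite mulmxDl map_mxD addrACA.
  by move=> i j; rewrite mxE (leq_trans (size_polyD _ _)) // geq_max ru sv.
have DZ c x : D x -> D (io c *: x).
  move=> [u [r [-> ru]]]; exists (io c *: u), (c%:P *: r); split.
    by rewrite scalerDr -scalemxAl map_scalemx.
  by move=> i j; rewrite mxE mul_polyC (leq_trans (size_scale_leq _ _)).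
have DG y : D (y *m G).
  by exists y, 0; rewrite map_mx0 addr0; split=> // i j; rewrite mxE size_poly0.
have DK z : D (t ^+ K *: z).
  by rewrite -mul_mx_scalar -HG mulmxA; apply: DG.
have Dtrunc (x : 'rV[ps]_n) : D (map_mx ofp (map_mx (pstrunc N) x)).
  exists 0, (map_mx (pstrunc N) x); rewrite mul0mx add0r; split=> // i j.
  by rewrite mxE size_poly.
have DN x : D x -> D (- x).
  by move=> Dx; have := DZ (- 1) x Dx; rewrite rmorphN1 scaleN1r.
pose b (p : 'I_n * 'I_(K - N)) : 'rV[ps]_n := t ^+ (N + p.2) *: delta_mx 0 p.1.
have Db : forall p, D (b p).
  pose X (p q : 'I_n * 'I_(K - N)) : R :=
    pscoef (t ^+ p.2 * G p.1 q.1) (N + q.2).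
  apply: (nakayama unit_f D0 DD DZ (X := X)) => p.
    move=> q; have /matrixP/(_ p.1 q.1) := fG; rewrite !mxE => fGpq.
    transitivity (pscoef (psmap f (t ^+ p.2 * G p.1 q.1)) (N + q.2));
      first by [].
    rewrite psmapXnM fGpq mulrnAr -exprD -ps_of_polyXn.
    have -> : (p == q) = (p.1 == q.1) && (q.2 + N == p.2 + N)%N.
      by rewrite eqn_add2r [val _ == _]eq_sym.
    by case: eqP => _; rewrite ?mulr0n // mulr1n /= coefXn addnC.
  have := DG (t ^+ p.2 *: delta_mx 0 p.1).
  rewrite -scalemxAl -rowE => Dx.
  have e := psrow_split (t ^+ p.2 *: row p.1 G) le_NK.
  have -> : \sum_j io (X p j) *: b j = t ^+ p.2 *: row p.1 G
     - map_mx ofp (map_mx (pstrunc N) (t ^+ p.2 *: row p.1 G))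
     - t ^+ K *: map_mx (psdrop K) (t ^+ p.2 *: row p.1 G).
    rewrite {1}e addrAC addrK addrC addKr.
    by apply: eq_bigr => q _; rewrite /X !mxE.
  exact: (DD _ _ (DD _ _ Dx (DN _ (Dtrunc _))) (DN _ (DK _))).
move=> x; rewrite (psrow_split x le_NK).
apply: (DD _ _ (DD _ _ (Dtrunc _) _) (DK _)).
by elim/big_ind: _ => // p _; apply/DZ/Db.
Qed.

Lemma weierstrass_factor n (G H : 'M[ps]_n) K N : (N <= K)%N ->
  G *m H = (t ^+ K)%:M -> map_mx (psmap f) G = (psX k ^+ N)%:M ->
  exists (Y : 'M[ps]_n) (Gam : 'M[{poly R}]_n),
    [/\ map_mx ofp Gam = Y *m G, map_mx (psmap f) Y = 1%:M & deg_le N Gam].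
Proof.
move=> le_NK /(mulmx_scalarC (@psXn_lreg R K)) HG fG.
have div := weierstrass_division le_NK HG fG.
have /choice[yr yrP] (i : 'I_n) : exists yr : 'rV[ps]_n * 'rV[{poly R}]_n,
    row i ((t ^+ N)%:M) = yr.1 *m G + map_mx ofp yr.2 /\
    forall j l, (size (yr.2 j l) <= N)%N.
  by have [y [r yr]] := div (row i (t ^+ N)%:M); exists (y, r).
pose Y := \matrix_(i, j) (yr i).1 0 j; pose r := \matrix_(i, j) (yr i).2 0 j.
have YG : (t ^+ N)%:M = Y *m G + map_mx ofp r.
  apply/row_matrixP => i; rewrite (yrP i).1; apply/rowP => j; rewrite !mxE.
  by congr (_ + _); apply: eq_bigr => l _; rewrite mxE.
have sr i j : (size (r i j) <= N)%N by rewrite mxE (yrP i).2.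
clearbody Y r.
have fYG : (psX k ^+ N)%:M = psX k ^+ N *: map_mx (psmap f) Y
                             + map_mx (@ps_of_poly k) (map_mx (map_poly f) r).
  rewrite -mul_mx_scalar -fG -map_mxM.
  transitivity (map_mx (psmap f) (t ^+ N)%:M : 'M_n).
    by rewrite map_scalar_mx /= psmapXn.
  rewrite YG map_mxD; congr (_ + _); apply/matrixP=> i j; rewrite !mxE.
  exact: psmap_ps_of_poly.
have fr : map_mx (map_poly f) r = 0.
  apply/matrixP=> i j; rewrite [LHS]mxE [RHS]mxE.
  apply/polyP=> n'; rewrite coef_map coef0.
  case: (ltnP n' N) => [lt_nN|le_Nn]; last first.
    by rewrite (nth_default _ (leq_trans (sr i j) le_Nn)) raddf0.
  have /matrixP/(_ i j) := fYG; rewrite [LHS]mxE [RHS]mxE.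
  rewrite [in X in _ = X + _]mxE [in X in _ = _ + X]mxE [in X in _ = _ + X]mxE.
  move=> /(congr1 (fun g => pscoef g n')).
  rewrite pscoefD pscoefXnM lt_nN add0r /= coef_map => <-.
  have := pscoefXnM N (1 : powerseries k) n'; rewrite mulr1 lt_nN => e.
  by case: (i == j); rewrite ?mulr1n ?mulr0n.
exists Y, ('X^N%:M - r); split.
- apply/eqP; rewrite map_mxB subr_eq -YG; apply/eqP.
  by rewrite map_scalar_mx /= ps_of_polyXn.
- apply: (@scalar_mx_inj _ _ (psX k ^+ N)); first exact: psXn_lreg.
  by rewrite scalemx1 fYG fr map_mx0 addr0.
- move=> i j; rewrite !mxE (leq_trans (size_polyD _ _)) // geq_max size_polyN.
  rewrite (leq_trans (sr i j)) // andbT.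
  by case: (i == j); rewrite ?mulr1n ?mulr0n ?size_polyXn ?size_poly0.
Qed.

Lemma psmap_unit1 (g : ps) : psmap f g = 1 -> exists h, g * h = 1.
Proof.
move=> fg; apply: psunit; apply: unit_f.
by have := congr1 (fun h => pscoef h 0) fg.
Qed.

Lemma weierstrass n (G H : 'M[ps]_n) K N : (N <= K)%N ->
  G *m H = (t ^+ K)%:M -> map_mx (psmap f) G = (psX k ^+ N)%:M ->
  exists (Y Y' : 'M[ps]_n) (Gam Gam' : 'M[{poly R}]_n),
    [/\ map_mx ofp Gam = Y *m G,
        Y *m Y' = 1%:M /\ map_mx (psmap f) Y = 1%:M,
        deg_le N Gam, deg_le (K - N) Gam' & Gam *m Gam' = ('X^K)%:M].
Proof.
move=> le_NK GH fG.
have [Y [Gam [YG fY dGam]]] := weierstrass_factor le_NK GH fG.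
have [Y' YY'] := mx_inv_lift psmap_unit1 fY.
pose H1 := H *m Y'.
have GamH : map_mx ofp Gam *m H1 = (t ^+ K)%:M.
  by rewrite YG mulmxA -(mulmxA Y) GH mul_mx_scalar -scalemxAl YY' scalemx1.
have HGam := mulmx_scalarC (@psXn_lreg R K) GamH.
have fGam : map_mx (psmap f) (map_mx ofp Gam) = (psX k ^+ N)%:M.
  by rewrite YG map_mxM fY mul1mx fG.
have fH1 : map_mx (psmap f) H1 = (psX k ^+ (K - N))%:M.
  apply: (@scalar_mx_inj _ _ (psX k ^+ N)); first exact: psXn_lreg.
  rewrite -mul_scalar_mx -fGam -map_mxM GamH map_scalar_mx /= psmapXn.
  by rewrite scale_scalar_mx -exprD subnKC.
have [Z [Gam1 [ZH fZ dGam1]]] := weierstrass_factor (leq_subr N K) HGam fH1.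
have [Z' ZZ'] := mx_inv_lift psmap_unit1 fZ.
pose cst := map_mx (@psconst R); pose pc := map_mx (@polyC R).
have ZE : map_mx ofp (Gam1 *m Gam) = t ^+ K *: Z.
  by rewrite map_mxM ZH -mulmxA HGam mul_mx_scalar.
have dGG : deg_le (K - N + N) (Gam1 *m Gam) by apply: deg_le_mulmx.
have Zc : Gam1 *m Gam = 'X^K *: pc _ _ (cst _ _ Z).
  apply/matrixP=> i j; apply/polyP => n'.
  transitivity (pscoef (t ^+ K * Z i j) n').
    by have /matrixP/(_ i j) := ZE; rewrite [LHS]mxE [RHS]mxE => <-.
  rewrite pscoefXnM [in RHS]mxE coefXnM [pc _ _ _ i j]mxE coefC.
  case: ltngtP => [//|lt_Kn|->]; last by rewrite subnn [cst _ _ Z i j]mxE.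
  have lt' : (K < n')%N by [].
  rewrite subn_eq0 leqNgt lt_Kn /=; transitivity ((Gam1 *m Gam) i j)`_n'.
    have /matrixP/(_ i j) := ZE; rewrite [LHS]mxE [RHS]mxE.
    move=> /(congr1 (fun g => pscoef g n')); rewrite pscoefXnM ltnNge ltnW //=.
  by rewrite nth_default // (leq_trans (dGG i j)) // subnK.
have d1 : cst _ _ Z *m cst _ _ Z' = 1%:M by rewrite -map_mxM ZZ' map_mx1.
exists Y, Y', Gam, (pc _ _ (cst _ _ Z') *m Gam1); split=> //.
  rewrite -[(K - N)%N]add0n; apply: deg_le_mulmx => // i j.
  by rewrite [pc _ _ _ i j]mxE size_polyC leq_b1.
apply: mulmx_scalarC; first exact/monic_lreg/monicXn.
by rewrite -mulmxA Zc -scalemxAr -map_mxM (mulmx1C d1) map_mx1 scalemx1.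
Qed.

End Weierstrass.

(** * Lifting from the residue field *)

Lemma delta00_row_mx (A : pzSemiRingType) n :
  delta_mx 0 0 = row_mx 1%:M 0 :> 'rV[A]_(1 + n).
Proof.
apply/rowP=> j; rewrite mxE; case: (split_ordP j) => l ->.
  by rewrite row_mxEl [l]ord1 !mxE !eqxx.
by rewrite row_mxEr mxE andTb.
Qed.

Lemma scale_delta00 (A : pzRingType) n (a : A) :
  a *: delta_mx 0 0 = row_mx a%:M 0 :> 'rV[A]_(1 + n).
Proof.
rewrite delta00_row_mx; apply: etrans (scale_row_mx _ _ _) _.
by rewrite scalemx1 scaler0.
Qed.

Lemma row_mx_head (A : pzSemiRingType) n (v : 'rV[A]_(1 + n)) :
  v = row_mx (v 0 0)%:M (rsubmx v).
Proof.
rewrite -[LHS]hsubmxK; congr row_mx; apply/rowP=> j.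
by rewrite !mxE [j]ord1 eqxx mulr1n; congr (v _ _); apply: val_inj.
Qed.

Lemma row_unit_entry (A : comPzRingType) n (u : 'rV[A]_n.+1) i c :
  u 0 i * c = 1 ->
  exists T T' : 'M_n.+1, T *m T' = 1%:M /\ u *m T = delta_mx 0 0.
Proof.
move=> uc; pose v : 'rV_(1 + n) := xcol 0 i u.
have v0 : v 0 0 * c = 1 by rewrite /v !mxE tpermL.
pose w := rsubmx v; pose a := v 0 0.
have vE : v = row_mx a%:M w by apply: row_mx_head.
pose T1 : 'M_(1 + n) := block_mx c%:M (- c *: w) 0 1%:M.
pose T1' : 'M_(1 + n) := block_mx a%:M w 0 1%:M.
have TT1 : T1 *m T1' = 1%:M.
  rewrite mulmx_block !mul0mx !mulmx0 !mulmx1 !add0r addr0 !mul_scalar_mx.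
  by rewrite scale_scalar_mx scaleNr subrr mulrC v0 -scalar_mx_block.
exists (tperm_mx 0 i *m T1), (T1' *m tperm_mx 0 i); split.
  by rewrite mulmxA -(mulmxA _ T1) TT1 mulmx1 -perm_mxM tperm2 perm_mx1.
have vT1 : v *m T1 = row_mx 1%:M 0.
  rewrite vE mul_row_block mulmx0 addr0 -scalar_mxM v0 mulmx1 mul_scalar_mx.
  by rewrite scalerA mulrN v0 scaleN1r addNr.
by rewrite mulmxA -xcolE delta00_row_mx; apply: vT1.
Qed.

Lemma block_mx_row0 (A : pzSemiRingType) n (X : 'M[A]_(1 + n)) a :
  row 0 X = a *: delta_mx 0 0 ->
  X = block_mx a%:M 0 (dlsubmx X) (drsubmx X).
Proof.
move=> X0; suff e : usubmx X = row_mx a%:M 0.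
  by rewrite -[LHS]submxK /ulsubmx /ursubmx e row_mxKl row_mxKr.
transitivity (row 0 X).
  by apply/matrixP=> i j; rewrite !mxE [i]ord1; congr (X _ _); apply: val_inj.
rewrite X0 delta00_row_mx; apply: etrans (scale_row_mx _ _ _) _.
by rewrite scalemx1 scaler0.
Qed.

Lemma row0_block_mx (A : pzSemiRingType) n a (x : 'M[A]_(n, 1)) X :
  row 0 (block_mx a%:M 0 x X : 'M_(1 + n)) = a *: delta_mx 0 0.
Proof.
transitivity (row (lshift n 0) (block_mx a%:M 0 x X)).
  by congr (row _ _); apply: val_inj.
rewrite rowKu row_id delta00_row_mx; apply: etrans (esym (scale_row_mx _ _ _)).
by rewrite scalemx1 scaler0.
Qed.

Section Lift.
Variables (R : comNzRingType) (k : fieldType) (f : {rmorphism R -> k}).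
Variable (g : k -> R).
Hypothesis gK : cancel g f.
Hypothesis unit_f : forall x, f x != 0 -> exists y, x * y = 1.
Local Notation ps := (powerseries R).
Local Notation t := (psX R).
Local Notation tk := (psX k).
Local Notation fps := (map_mx (psmap f)).

Definition pslift (h : powerseries k) : ps := PowerSeries (fun n
  => g (pscoef h n)).

Lemma psliftK : cancel pslift (psmap f).
Proof. by move=> h; apply: powerseriesP => n /=; rewrite gK. Qed.

Lemma pslift_mxK m n (X : 'M_(m, n)) : fps (map_mx pslift X) = X.
Proof. by apply/matrixP=> i j; rewrite !mxE psliftK. Qed.

Lemma psrow_pivot n (x : 'rV[powerseries k]_n.+1) (y : 'cV_n.+1) M :
  x *m y = (tk ^+ M)%:M ->
  exists (T T' : 'M[ps]_n.+1) e,
    [/\ (e <= M)%N, T *m T' = 1%:M & x *m fps T = tk ^+ e *: delta_mx 0 0].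
Proof.
move=> xy; pose nz m := [exists i, pscoef (x 0 i) m != 0].
have x_lt m i : (forall j, (j < m)%N -> ~~ nz j) ->
    x 0 i = tk ^+ m * psdrop m (x 0 i).
  move=> lt; apply: powerseriesP => j; rewrite pscoefXnM.
  case: ltnP => [/lt/existsPn/(_ i)/negPn/eqP //|le_mj].
  by rewrite /= subnKC.
have ex_nz : exists m, nz m && (m <= M)%N.
  apply: contrapT => Nex.
  have x0 i : x 0 i = tk ^+ M.+1 * psdrop M.+1 (x 0 i).
    apply: x_lt => j lt_jM; apply/negP => nzj; apply: Nex; exists j.
    by rewrite nzj.
  have /matrixP/(_ 0 0) := xy; rewrite !mxE eqxx mulr1n => /(congr1 (fun h
    => pscoef h M)).
  under eq_bigr do rewrite x0 -mulrA.
  rewrite -mulr_sumr pscoefXnM ltnSn -[tk ^+ M]mulr1 pscoefXnM ltnn subnn.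
  by move/esym/eqP; rewrite oner_eq0.
case: (ex_minnP ex_nz) => e /andP[/existsP[i xie] le_eM] min_e.
have xE j : x 0 j = tk ^+ e * psdrop e (x 0 j).
  apply: x_lt => l lt_le; apply/negP => nzl; have := min_e l.
  by rewrite nzl (leq_trans (ltnW lt_le) le_eM) leqNgt lt_le => /(_ isT).
pose u : 'rV[ps]_n.+1 := map_mx pslift (map_mx (psdrop e) x).
have [|c uc] := @psunit R (u 0 i).
  by apply: unit_f; rewrite /u !mxE /psconst /= gK addn0.
have [T [T' [TT' uT]]] := row_unit_entry uc.
exists T, T', e; split=> //.
have -> : x = tk ^+ e *: fps u.
  by rewrite pslift_mxK; apply/rowP=> j; rewrite !mxE.
by rewrite -scalemxAl -map_mxM uT map_delta_mx.
Qed.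

Lemma gl_lift_block n (X X' : 'M[powerseries k]_(1 + n)) K a
    (IH : forall (Y Y' : 'M[powerseries k]_n), Y *m Y' = (tk ^+ K)%:M ->
      exists (b b' : 'M[ps]_n) L N,
        b *m b' = (t ^+ L)%:M /\ fps b *m Y = (tk ^+ N)%:M) :
  X *m X' = (tk ^+ K)%:M -> row 0 X = tk ^+ a *: delta_mx 0 0 ->
  exists (b b' : 'M[ps]_(1 + n)) L c,
    [/\ b *m b' = (t ^+ L)%:M, row 0 b = t ^+ c *: delta_mx 0 0
      & fps b *m X = (tk ^+ (c + a))%:M].
Proof.
move=> XX' X0.
have XE := block_mx_row0 X0.
move: XE; set x := dlsubmx _; set X1 := drsubmx _ => XE.
pose P := ursubmx X'; pose Q := drsubmx X'.
have XQ : X1 *m Q = (tk ^+ K)%:M.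
  move: XX'; rewrite XE -[X']submxK mulmx_block scalar_mx_block.
  case/eq_block_mx => _; rewrite mul0mx addr0 mul_scalar_mx -/P -/Q => P0 _ <-.
  have -> : P = 0.
    by apply: (scalar_mx_inj (@psXn_lreg k a)); rewrite P0 scaler0.
  by rewrite mulmx0 add0r.
have [b [b' [L [N [bb' bX]]]]] := IH _ _ XQ.
pose Z := map_mx pslift (fps b *m x).
exists (block_mx (t ^+ N)%:M 0 (- Z) (t ^+ a *: b) : 'M_(1 + n)),
  (block_mx (t ^+ (a + L))%:M 0 (b' *m Z) (t ^+ N *: b') : 'M_(1 + n)),
  (N + (a + L))%N, N; split.
- rewrite mulmx_block !mul0mx !mulmx0 !addr0 add0r -scalar_mxM -exprD.
  rewrite -!scalemxAl -!scalemxAr mulmxA bb' mul_mx_scalar mul_scalar_mx.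
  rewrite !scalerA !scale_scalar_mx -!exprD scalerN addNr.
  rewrite (_ : a + N + L = N + (a + L))%N ?scalar_mx_block //; lia.
- exact: row0_block_mx.
- rewrite XE map_block_mx mulmx_block map_scalar_mx /= psmapXn map_mx0.
  rewrite !mul0mx !mulmx0 !addr0 add0r -scalar_mxM -exprD map_mxN pslift_mxK.
  rewrite map_scalemx /= psmapXn -!scalemxAl mul_mx_scalar bX scalerN addNr.
  by rewrite scale_scalar_mx -exprD [(a + N)%N]addnC -scalar_mx_block.
Qed.

Lemma gl_lift n (X X' : 'M[powerseries k]_n) K : X *m X' = (tk ^+ K)%:M ->
  exists (b b' : 'M[ps]_n) L N,
    b *m b' = (t ^+ L)%:M /\ fps b *m X = (tk ^+ N)%:M.
Proof.
elim: n X X' => [|n IHn] X X' XX'.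
  exists 1%:M, 1%:M, 0, 0; split; first by rewrite mulmx1 expr0.
  by apply/matrixP=> -[].
have xy : row 0 X *m col 0 X' = (tk ^+ K)%:M.
  apply/matrixP=> i j; have /matrixP/(_ 0 0) := XX'.
  by rewrite [i]ord1 [j]ord1 !mxE => <-; apply: eq_bigr => l _; rewrite !mxE.
have [T [T' [e [_ TT' xT]]]] := psrow_pivot xy.
have fTT : fps T *m fps T' = 1%:M by rewrite -map_mxM TT' map_mx1.
have [|||b [b' [L [c [bb' _ bX]]]]] :=
  @gl_lift_block n (X *m fps T) (fps T' *m X') K e.
- by move=> Y Y'; apply: IHn.
- by rewrite mulmxA -(mulmxA X) fTT mulmx1.
- by rewrite row_mul.
exists (T *m b), (b' *m T'), L, (c + e)%N; split.
  by rewrite mulmxA -(mulmxA T) bb' mul_mx_scalar -scalemxAl TT' scalemx1.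
rewrite map_mxM -[LHS]mulmx1 -fTT -(mulmxA (fps T)) (mulmxA _ (fps T)).
rewrite -(mulmxA (fps T)) -(mulmxA (fps b)) bX mul_mx_scalar -scalemxAl fTT.
by rewrite scalemx1.
Qed.

End Lift.

(** * Exchanging the variable with its inverse *)

Section Reversal.
Variable R : comNzRingType.
Implicit Types p q : {poly R}.

Definition revp D p : {poly R} := \poly_(i < D.+1) p`_(D - i).

Lemma revp_is_zmod_morphism D : zmod_morphism (revp D).
Proof.
move=> p q; apply/polyP=> i; rewrite coefB !coef_poly coefB.
by case: ifP; rewrite ?subr0.
Qed.

HB.instance Definition _ D :=
  GRing.isZmodMorphism.Build _ _ (revp D) (revp_is_zmod_morphism D).

Lemma revpZ D c p : revp D (c *: p) = c *: revp D p.
Proof.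
apply/polyP=> i; rewrite coefZ !coef_poly coefZ.
by case: ifP; rewrite ?mulr0.
Qed.

Lemma revpXn D i : (i <= D)%N -> revp D 'X^i = 'X^(D - i).
Proof.
move=> le_iD; apply/polyP=> j; rewrite coef_poly !coefXn.
case: ltnP => [le_jD|lt_Dj]; last by rewrite (gtn_eqF (leq_ltn_trans (leq_subr
  _ _) lt_Dj)).
by congr (nat_of_bool _)%:R; apply/eqP/eqP; lia.
Qed.

Lemma revp1 D : revp D 1 = 'X^D.
Proof. by rewrite -(expr0 'X) revpXn // subn0. Qed.

Lemma poly_sumXn D p : (size p <= D)%N ->
  p = \sum_(i < D) p`_i *: 'X^i.
Proof.
move=> sp; rewrite -poly_def; apply/polyP=> i; rewrite coef_poly.
by case: ltnP => // le; rewrite nth_default // (leq_trans sp).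
Qed.

Lemma revpM D E p q : (size p <= D.+1)%N -> (size q <= E.+1)%N ->
  revp (D + E) (p * q) = revp D p * revp E q.
Proof.
move=> /poly_sumXn -> /poly_sumXn ->; rewrite big_distrl !raddf_sum /=.
rewrite mulr_suml; apply: eq_bigr => i _; rewrite big_distrr raddf_sum /=.
rewrite mulr_sumr; apply: eq_bigr => j _.
have le_i := leq_ord i; have le_j := leq_ord j.
rewrite -scalerAl -scalerAr -exprD !revpZ !revpXn ?leq_add //.
rewrite -scalerAl -scalerAr -exprD; congr (_ *: (_ *: 'X^_)); lia.
Qed.

Lemma size_revp D p : (size (revp D p) <= D.+1)%N.
Proof. exact: size_poly. Qed.

Lemma revpK D p : (size p <= D.+1)%N -> revp D (revp D p) = p.
Proof.
move=> sp; apply/polyP=> i; rewrite !coef_poly; case: ltnP => [le_iD|lt_Di].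
  by rewrite ltnS leq_subr subKn.
by rewrite nth_default // (leq_trans sp).
Qed.

Lemma map_mx_revpM m n l D E (X : 'M[{poly R}]_(m, n)) (Y : 'M_(n, l)) :
  deg_le D X -> deg_le E Y ->
  map_mx (revp (D + E)) (X *m Y) = map_mx (revp D) X *m map_mx (revp E) Y.
Proof.
move=> dX dY; apply/matrixP=> i j; rewrite !mxE raddf_sum.
by apply: eq_bigr => h _; rewrite !mxE -revpM.
Qed.

Lemma ex_deg_le m n (X : 'M[{poly R}]_(m, n)) : exists d, deg_le d X.
Proof.
exists (\max_i \max_j size (X i j)) => i j; rewrite ltnW // ltnS.
apply: leq_trans (leq_bigmax i).
exact: (leq_bigmax (F := fun j => size (X i j)) j).
Qed.

Lemma deg_leW m n d e (X : 'M[{poly R}]_(m, n)) :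
  (d <= e)%N -> deg_le d X -> deg_le e X.
Proof. by move=> le_de dX i j; apply: leq_trans (dX i j) _. Qed.

Section Transfer.
Variables S S' : mulrClosed {poly R}.
Hypothesis revS : forall D p, p \in S -> (size p <= D.+1)%N -> revp D p \in S'.

Lemma map_revp_scalar n D p : map_mx (revp D) (p%:M : 'M_n) = (revp D p)%:M.
Proof. by apply/matrixP=> i j; rewrite !mxE raddfMn. Qed.

Lemma unimodular_rev n (v : 'rV[{poly R}]_n.+1) D :
  deg_le D v -> unimodular S v -> unimodular S' (map_mx (revp D) v).
Proof.
move=> dv [s sS [w vw]]; have [E dw] := ex_deg_le w.
exists (revp (D + E) s).
  by apply: revS => //; have := deg_le_mulmx dv dw 0 0; rewrite vw mxE.
by exists (map_mx (revp E) w); rewrite -map_mx_revpM // vw map_revp_scalar.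
Qed.

Lemma completable_rev n (v : 'rV[{poly R}]_n.+1) D :
  deg_le D v -> completable S v -> completable S' (map_mx (revp D) v).
Proof.
move=> dv [G [H [s [c [sS cS GH G0]]]]].
have [e dG] := ex_deg_le G; have [F dH] := ex_deg_le H.
pose E := (e + size c)%N.
have {}dG : deg_le (E + D) G by apply: deg_leW dG; rewrite -!addnA leq_addr.
have sc : (size c <= E.+1)%N by rewrite leqW // leq_addl.
exists (map_mx (revp (E + D)) G), (map_mx (revp F) H),
  (revp (E + D + F) s), (revp E c); split.
- by apply: revS => //; have := deg_le_mulmx dG dH 0 0; rewrite GH mxE.
- exact: revS.
- by rewrite -map_mx_revpM // GH map_revp_scalar.
- by rewrite -map_row G0; apply/matrixP=> i j; rewrite !mxE revpM.
Qed.

End Transfer.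

(* Up to a power of ['X], the comonic polynomials are the monic polynomials in
   the inverse of ['X]. *)
Definition comonic : {pred {poly R}} :=
  [pred p | `[< exists M q, p = 'X^M * (1 + 'X * q) >]].

Lemma comonic_mulr_closed : mulr_closed comonic.
Proof.
split=> [|_ _ /asboolP[M [p ->]] /asboolP[N [q ->]]]; apply/asboolP.
  by exists 0, 0; rewrite mulr0 addr0 mulr1 expr0.
by exists (M + N)%N, (p + q + 'X * p * q); rewrite exprD; ring.
Qed.

HB.instance Definition _ :=
  GRing.isMulClosed.Build {poly R} comonic comonic_mulr_closed.

Lemma comonicE M p : p`_M = 1 -> (forall i, (i < M)%N -> p`_i = 0) ->
  p = 'X^M * (1 + 'X * drop_poly M.+1 p).
Proof.
move=> pM p0; apply/polyP=> i; rewrite coefXnM.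
case: ltnP => [/p0 //|le_Mi]; rewrite coefD coef1 coefXM coef_drop_poly.
rewrite subn_eq0; case: (ltngtP i M) le_Mi => [//|lt_Mi|->] _.
  by rewrite add0r; congr _`_(_); lia.
by rewrite pM addr0.
Qed.

Lemma comonicP p :
  reflect (exists M, p`_M = 1 /\ forall i, (i < M)%N -> p`_i = 0)
          (p \in comonic).
Proof.
apply: (iffP (asboolP _)) => [[M [q ->]]|[M [pM p0]]].
  exists M; rewrite !coefXnM ltnn subnn coefD coef1 coefXM /= addr0.
  by split=> // i lt_iM; rewrite coefXnM lt_iM.
by exists M, (drop_poly M.+1 p); apply: comonicE.
Qed.

Lemma revp_monic D p : p \is monic -> (size p <= D.+1)%N
  -> revp D p \in comonic.
Proof.
move=> mp sp; have p0 : (0 < size p)%N by rewrite size_poly_gt0 monic_neq0.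
apply/comonicP; exists (D - (size p).-1)%N; split=> [|i lt_i];
  rewrite coef_poly.
  rewrite ltnS leq_subr subKn; first exact/eqP.
  by rewrite -ltnS prednK.
case: ifP => // _; rewrite nth_default //.
by move: (size p) p0 sp lt_i => s; lia.
Qed.

Lemma revp_comonic D p : p \in comonic -> (size p <= D.+1)%N
  -> revp D p \is monic.
Proof.
move=> /comonicP[M [pM p0]] sp.
have lt_MD : (M < D.+1)%N.
  rewrite ltnNge; apply/negP => le; move/eqP: pM.
  by rewrite nth_default ?(leq_trans sp) // eq_sym oner_eq0.
suff e : size (revp D p) = (D - M).+1.
  apply/eqP; rewrite /lead_coef e /= coef_poly ltnS leq_subr subKn //.
apply/eqP; rewrite eqn_leq; apply/andP; split.
  apply/leq_sizeP => j le; rewrite coef_poly; case: ifP => // le'.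
  by apply: p0; lia.
apply: contraT; rewrite -leqNgt => /leq_sizeP/(_ _ (leqnn _)).
rewrite coef_poly ltnS leq_subr subKn // pM => /eqP; by rewrite oner_eq0.
Qed.

Lemma revp_powersX D p :
  p \in powers 'X -> (size p <= D.+1)%N -> revp D p \in powers 'X.
Proof.
move=> /powersP[m ->]; rewrite size_polyXn ltnS => le_mD.
by rewrite revpXn // powersX.
Qed.

Lemma revp_powers1 D p :
  p \in powers 1 -> (size p <= D.+1)%N -> revp D p \in powers 'X.
Proof. by rewrite powers1 => /eqP -> _; rewrite revp1 powersX. Qed.

End Reversal.

(** * Horrocks' theorem *)

Lemma completable_delta (A : comPzRingType) (S : mulrClosed A) n :
  completable S (delta_mx 0 0 : 'rV_n.+1).
Proof.
exists 1%:M, 1%:M, 1, 1; rewrite rpred1 mulmx1 scale1r; split=> //.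
by apply/rowP=> j; rewrite !mxE eq_sym.
Qed.

Lemma completable_unit_entry (A : comPzRingType) (S : mulrClosed A) n
    (u : 'rV[A]_n.+1) i c : u 0 i * c = 1 -> completable S u.
Proof.
move=> /row_unit_entry[T [T' [TT' uT]]].
apply: (completable_mul (@GRing.lreg1 A) (rpred1 S) TT').
by rewrite uT; apply: completable_delta.
Qed.

Lemma completable_scaleW (A : comPzRingType) (S : mulrClosed A) n
    (v : 'rV[A]_n.+1) c :
  c \in S -> completable S v -> completable S (c *: v).
Proof.
move=> cS [G [H [s [d [sS dS GH G0]]]]]; exists (c *: G), H, (c * s), d.
split; rewrite ?rpredM //; first by rewrite -scalemxAl GH scale_scalar_mx.
by rewrite scalerA mulrC -scalerA -G0; apply/rowP=> j; rewrite !mxE.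
Qed.

Lemma completable_subset (A : comPzRingType) (S S' : mulrClosed A) n
    (v : 'rV[A]_n.+1) :
  {subset S <= S'} -> completable S v -> completable S' v.
Proof.
move=> sSS' [G [H [s [c [sS cS GH G0]]]]].
by exists G, H, s, c; split; rewrite ?sSS'.
Qed.

Lemma unimodular_comax (A : comPzRingType) n (v : 'rV[A]_n.+1) (w : 'cV_n.+1)
    (x : A) L :
  v *m w = (x ^+ L)%:M ->
  (exists (w' : 'cV_n.+1) z, v *m w' = (1 - x * z)%:M) ->
  unimodular (powers 1) v.
Proof.
move=> vw [w' [z vw']]; exists 1; first by rewrite rpred1.
exists (z ^+ L *: w + (\sum_(i < L) (x * z) ^+ i) *: w').
rewrite mulmxDr -!scalemxAr vw vw' !scale_scalar_mx -raddfD /= mulrC.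
rewrite -exprMn [_ * (1 - _)]mulrC -opprB mulNr -subrX1 opprB.
by rewrite addrC subrK.
Qed.

Section Horrocks.
Variables (R : comNzRingType) (k : fieldType) (f : {rmorphism R -> k}).
Variable (g : k -> R).
Hypothesis gK : cancel g f.
Hypothesis unit_f : forall x, f x != 0 -> exists y, x * y = 1.
Local Notation ps := (powerseries R).
Local Notation t := (psX R).
Local Notation ofp := (@ps_of_poly R).
Local Notation fp := (map_mx (map_poly f)).
Local Notation fps := (map_mx (psmap f)).

Lemma unit_f1 x : f x = 1 -> exists y, x * y = 1.
Proof. by move=> fx; apply: unit_f; rewrite fx oner_eq0. Qed.

Definition plift (p : {poly k}) : {poly R} := \poly_(i < size p) g p`_i.

Lemma pliftK : cancel plift (map_poly f).
Proof.
move=> p; apply/polyP=> i; rewrite coef_map coef_poly.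
by case: ltnP => [_|le]; [rewrite /= gK | rewrite nth_default ?raddf0].
Qed.

Lemma plift_mxK m n (X : 'M_(m, n)) : fp (map_mx plift X) = X.
Proof. by apply/matrixP=> i j; rewrite !mxE pliftK. Qed.

Lemma row_euclid n (v : 'rV[{poly R}]_n.+1) :
  exists (T T' : 'M_n.+1) (d : {poly k}),
    T *m T' = 1%:M /\ fp (v *m T) = d *: delta_mx 0 0.
Proof.
pose P m := `[< exists (T T' : 'M_n.+1) i,
  [/\ T *m T' = 1%:M, size (fp (v *m T) 0 i) = m & (0 < m)%N] >].
have [exP|Nex] := pselect (exists m, P m); last first.
  exists 1%:M, 1%:M, 0; rewrite !mulmx1; split=> //; rewrite scale0r.
  apply/rowP=> i; rewrite [RHS]mxE; apply/eqP; rewrite -size_poly_eq0.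
  apply: contrapT => /negP; rewrite -lt0n => nz; apply: Nex.
  exists (size (fp v 0 i)); apply/asboolP; exists 1%:M, 1%:M, i.
  by rewrite !mulmx1.
case: (ex_minnP exP) => m /asboolP[T [T' [i [TT' sm m0]]]] min_m.
pose x : 'rV_(1 + n) := fp (v *m T *m tperm_mx 0 i).
have x0 : x 0 0 = fp (v *m T) 0 i.
  by rewrite /x -xcolE; rewrite !mxE tpermL.
pose a : {poly k} := x 0 0.
have [w xE] : exists w, x = row_mx a%:M w by exists (rsubmx x);
  apply: row_mx_head.
pose q := \row_j (w 0 j %/ a).
have Ea : size a = m by rewrite /a x0.
pose T1 : 'M_(1 + n) := block_mx 1%:M (- map_mx plift q) 0 1%:M.
pose T1' : 'M_(1 + n) := block_mx 1%:M (map_mx plift q) 0 1%:M.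
have TT1 : T1 *m T1' = 1%:M.
  rewrite mulmx_block !mul0mx !mulmx0 !mulmx1 !mul1mx !add0r addr0 subrr.
  by rewrite -scalar_mx_block.
pose U := T *m tperm_mx 0 i *m T1; pose U' := T1' *m tperm_mx 0 i *m T'.
have UU' : U *m U' = 1%:M.
  rewrite /U /U' !mulmxA -(mulmxA _ T1) TT1 mulmx1.
  by rewrite -(mulmxA T) -perm_mxM tperm2 perm_mx1 mulmx1.
have xT1 : fp (v *m U) = row_mx a%:M (\row_j (w 0 j %% a)).
  have -> : fp (v *m U) = x *m fp T1 by rewrite /U !mulmxA map_mxM.
  rewrite xE map_block_mx mul_row_block !map_mx1 map_mx0.
  rewrite map_mxN plift_mxK !mulmx0 !mulmx1 addr0 mul_scalar_mx; congr row_mx.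
  by apply/rowP=> j; rewrite !mxE {2}(divp_eq (w 0 j) a) mulrN [a * _]mulrC
    addKr.
exists U, U', a; split=> //; rewrite xT1;
  apply: etrans (esym (scale_delta00 _ _)).
congr row_mx; apply/rowP=> j; rewrite [RHS]mxE; apply/eqP;
  rewrite -size_poly_eq0.
apply: contrapT => /negP; rewrite -lt0n => nz.
set r := (X in size X) in nz; have lt_m : (size r < m)%N.
  by rewrite -Ea /r mxE ltn_modp -size_poly_gt0 Ea.
have := min_m (size r); rewrite leqNgt lt_m => F; suff: false by []; apply: F.
apply/asboolP; exists U, U', (rshift 1 j); rewrite nz; split=> //.
by congr (size (polyseq _)); rewrite xT1; apply: row_mxEr.
Qed.

Lemma row_euclid_powersX n (v : 'rV[{poly R}]_n.+1) (w : 'cV_n.+1) M :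
  v *m w = ('X^M)%:M ->
  exists (T T' : 'M_n.+1) d,
    [/\ (d <= M)%N, T *m T' = 1%:M & fp (v *m T) = 'X^d *: delta_mx 0 0].
Proof.
move=> vw; have [T [T' [d [TT' vT]]]] := row_euclid v.
have d_dvd : d %| ('X - 0%:P) ^+ M.
  have : fp (v *m T) *m fp (T' *m w) = ('X^M)%:M.
    rewrite -map_mxM mulmxA -(mulmxA v) TT' mulmx1 vw map_scalar_mx /=.
    by rewrite map_polyXn.
  rewrite vT -scalemxAl => /matrixP/(_ 0 0); rewrite [LHS]mxE [RHS]mxE mulr1n.
  by rewrite subr0 => <-; apply: dvdp_mulIl.
have /dvdp_exp_XsubCP[e le_eM /eqpP[[c1 c2] /= /andP[c1nz c2nz] dE]] := d_dvd.
rewrite subr0 in dE.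
have lift_unit c : c != 0 -> exists y, g c * y = 1.
  by move=> c0; apply: unit_f; rewrite gK.
have [|y cy] := lift_unit (c1 / c2); first by rewrite mulf_neq0 ?invr_eq0.
pose c := g (c1 / c2).
exists (T *m c%:P%:M), (y%:P%:M *m T'), e; split=> //.
  rewrite mulmxA -(mulmxA T) -scalar_mxM -polyCM cy mulmx1 //.
rewrite mulmxA map_mxM vT map_scalar_mx mul_mx_scalar scalerA /= map_polyC /=
  gK.
congr (_ *: _); rewrite mul_polyC mulrC -scalerA dE scalerA mulVf //.
by rewrite scale1r.
Qed.

Lemma map_ofp_inj m n : injective (fun X : 'M[{poly R}]_(m, n) => map_mx ofp X).
Proof.
move=> X Y e; apply/matrixP=> i j; apply: (@ps_of_poly_inj R).
by have /matrixP/(_ i j) := e; rewrite !mxE.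
Qed.

Lemma map_psmap_ofp m n (X : 'M[{poly R}]_(m, n)) :
  fps (map_mx ofp X) = map_mx (@ps_of_poly k) (fp X).
Proof. by apply/matrixP=> i j; rewrite !mxE psmap_ps_of_poly. Qed.

(* A completion [G] of [V] over the Laurent series is a gluing datum for a
   vector bundle on the projective line. Changing the lattice at [t = 0] by [b]
   makes the bundle trivial modulo the maximal ideal, hence trivial, and [V]
   becomes a section of a trivial bundle. *)
Lemma completable_factor n (V : 'rV[{poly R}]_n.+1) d :
  fp V = 'X^d *: delta_mx 0 0 ->
  completable (powers t) (map_mx ofp V) ->
  exists (u : 'rV[{poly R}]_n.+1) (Gam Gam' : 'M[{poly R}]_n.+1) c K,
    [/\ 'X^c *: V = u *m Gam, fp u = delta_mx 0 0,
        Gam *m Gam' = ('X^K)%:M /\ (c + d <= K)%N,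
        deg_le (c + d) Gam /\ deg_le (K - (c + d)) Gam'
      & forall D, (d <= D)%N -> deg_le D V -> deg_le (D - d) u].
Proof.
move=> fV [G [H [s [c0 [/powersP[K0 ->] /powersP[a ->] GH G0]]]]].
have fGH : fps G *m fps H = (psX k ^+ K0)%:M.
  by rewrite -map_mxM GH map_scalar_mx /= psmapXn.
have fG0 : row 0 (fps G) = psX k ^+ (a + d) *: delta_mx 0 0.
  rewrite -map_row G0 map_scalemx /= psmapXn map_psmap_ofp fV map_scalemx.
  by rewrite map_delta_mx /= ps_of_polyXn scalerA exprD.
have IH (Y Y' : 'M[powerseries k]_n) := @gl_lift _ _ _ _ gK unit_f n Y Y' K0.
have [b [b' [L [c1 [bb' b0 bG]]]]] := gl_lift_block gK IH fGH fG0.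
pose c := (c1 + a)%N; pose K := (K0 + L + (c + d))%N.
have le_cK : (c + d <= K)%N by rewrite leq_addl.
have GK : (b *m G) *m (H *m (t ^+ (c + d) *: b')) = (t ^+ K)%:M.
  rewrite mulmxA -(mulmxA b) GH mul_mx_scalar -scalemxAl -scalemxAr bb'.
  by rewrite !scale_scalar_mx -!exprD /K; congr (t ^+ _)%:M; lia.
have fbG : fps (b *m G) = (psX k ^+ (c + d))%:M.
  by rewrite map_mxM bG /c addnA.
have [Y [Y' [Gam [Gam' [YG [YY' fY] dGam dGam' GG']]]]] :=
  weierstrass unit_f1 le_cK GK fbG.
have Y'Y := mulmx1C YY'.
pose us := row 0 Y'.
have VE : map_mx ofp ('X^c *: V) = us *m map_mx ofp Gam.
  rewrite YG mulmxA -row_mul Y'Y -row_mul mul1mx row_mul b0 -scalemxAl -rowE G0.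
  by rewrite scalerA -exprD map_scalemx /= ps_of_polyXn.
have usE : map_mx ofp ('X^c *: V *m Gam') = t ^+ K *: us.
  rewrite map_mxM VE -mulmxA -map_mxM GG' map_scalar_mx /= ps_of_polyXn.
  by rewrite mul_mx_scalar.
pose u := map_mx (drop_poly K) ('X^c *: V *m Gam').
have uE : map_mx ofp u = us.
  apply/rowP=> j; apply: powerseriesP => i; rewrite /u [X in pscoef X]mxE.
  rewrite [X in ofp X]mxE /= coef_drop_poly.
  have /rowP/(_ j) := usE; rewrite [LHS]mxE [RHS]mxE.
  move=> /(congr1 (fun h => pscoef h (i + K))).
  by rewrite pscoefXnM ltnNge leq_addl addnK.
exists u, Gam, Gam', c, K; split=> //.
- by apply: map_ofp_inj; rewrite VE map_mxM uE.
- apply/rowP=> j; apply: (@ps_of_poly_inj k).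
  have := map_psmap_ofp u; rewrite uE => /rowP/(_ j); rewrite [RHS]mxE => <-.
  have -> : us = delta_mx 0 0 *m Y' by rewrite -rowE.
  have fY' : fps Y' = 1%:M.
    by rewrite -[LHS]mul1mx -fY -map_mxM YY' map_mx1.
  by rewrite map_mxM fY' mulmx1 map_delta_mx !mxE rmorph_nat.
- move=> D le_dD dV i j; rewrite mxE size_drop_poly.
  have dVG : deg_le (c + D + (K - (c + d))) ('X^c *: V *m Gam').
    apply: deg_le_mulmx => // i' j'; rewrite mxE.
    rewrite (leq_trans (size_polyMleq _ _)) // size_polyXn addSn /= -addnS.
    by rewrite leq_add2l dV.
  have := dVG i j; move: (size _) => sz; lia.
Qed.

Lemma laurent_series_to_poly :
  rows_completable (powers t) -> rows_completable (powers (1 : {poly R})).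
Proof.
move=> cps n v0 [s]; rewrite powers1 => /eqP -> [w0 v0w].
have [|T [T' [d [d0 TT' fv]]]] := @row_euclid_powersX n v0 w0 0.
  by rewrite v0w expr0.
apply: (completable_mul (@GRing.lreg1 _) (rpred1 _) TT').
move: d0 fv; rewrite leqn0 => /eqP ->; rewrite expr0 scale1r.
have : unimodular (powers (1 : {poly R})) (v0 *m T).
  apply: unimodular_mul TT' _; first by rewrite rpred1.
  by exists 1; [rewrite rpred1|exists w0].
move: (v0 *m T) => v uv fv; have [D dv] := ex_deg_le v.
pose V := map_mx (revp D) v.
have fV : fp V = 'X^D *: delta_mx 0 0.
  apply/rowP=> j; have /rowP/(_ j) := fv; rewrite !mxE => fvj.
  transitivity (revp D (map_poly f (v 0 j))).
    apply/polyP=> i; rewrite coef_map [RHS]coef_poly /= [X in f X]coef_poly.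
    by case: ifP; rewrite ?raddf0 // coef_map.
  rewrite fvj; case: (_ && _); rewrite ?mulr1n ?mulr0n ?mulr1 ?mulr0 ?revp1 //.
  exact: raddf0.
have uV : unimodular (powers 'X) V by apply: unimodular_rev dv uv;
  apply: revp_powers1.
have cV : completable (powers t) (map_mx ofp V).
  apply/cps/unimodular_map/uV => _ /powersP[i ->].
  by rewrite /= ps_of_polyXn powersX.
have dV : deg_le D V by move=> i j; rewrite mxE size_revp.
have [u [Gam [Gam' [c [K [VE fu [GG' le_cK] [dG dG'] /(_ D (leqnn D) dV)]]]]]]
  :=
  completable_factor fV cV.
rewrite subnn => du.
pose rG := map_mx (revp (c + D)) Gam; pose rG' := map_mx (revp (K - (c
  + D))) Gam'.
have rGG' : rG *m rG' = 1%:M.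
  by rewrite -map_mx_revpM // GG' subnKC // map_revp_scalar revpXn // subnn
    expr0.
have vE : v = u *m rG.
  transitivity (map_mx (revp (c + D)) ('X^c *: V)).
    apply/rowP=> j; rewrite !mxE revpM ?size_revp ?size_polyXn //.
    by rewrite revpXn // subnn expr0 mul1r revpK.
  rewrite VE; have := map_mx_revpM du dG; rewrite add0n => ->; congr (_ *m _).
  apply/rowP=> j; rewrite mxE; apply/polyP => i; rewrite coef_poly ltnS leqn0.
  by case: eqP => [->//|/eqP]; rewrite -lt0n => lt0;
    rewrite nth_default // (leq_trans (du _ _)).
apply: (completable_mul (@GRing.lreg1 _) (rpred1 _) (mulmx1C rGG')).
rewrite vE -mulmxA rGG' mulmx1.
have u00 : u 0 0 = ((u 0 0)`_0)%:P by apply: size1_polyC; apply: du.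
have [|y uy] := @unit_f1 (u 0 0)`_0.
  have /rowP/(_ 0) := fu; rewrite !mxE eqxx => /(congr1 (fun p : {poly k}
    => p`_0)).
  by rewrite coef_map coef1.
by apply: (@completable_unit_entry _ _ _ _ 0 y%:P); rewrite u00 -polyCM uy.
Qed.

Lemma poly_to_laurent_poly :
  rows_completable (powers (1 : {poly R})) -> rows_completable (powers t) ->
  rows_completable (powers ('X : {poly R})).
Proof.
move=> cpoly cps n v0 uv0; have [_ /powersP[M ->] [w0 v0w]] := uv0.
have [T [T' [d [_ TT' fv]]]] := row_euclid_powersX v0w.
apply: (completable_mul (@GRing.lreg1 _) (rpred1 _) TT').
have uv : unimodular (powers 'X) (v0 *m T).
  by apply: unimodular_mul TT' uv0; rewrite rpred1.
move: (v0 *m T) uv fv => v uv fv {v0 w0 v0w uv0 T T' TT'}.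
have cv : completable (powers t) (map_mx ofp v).
  apply/cps/unimodular_map/uv => _ /powersP[i ->].
  by rewrite /= ps_of_polyXn powersX.
have [u [Gam [Gam' [c [K [vE fu [GG' _] _ _]]]]]] := completable_factor fv cv.
have regX m : GRing.lreg ('X^m : {poly R}) by apply/monic_lreg/monicXn.
apply: (@completable_scale _ _ _ _ 'X^c); first exact: powersX.
rewrite vE; apply: (completable_mul (regX K) (powersX _ _) (mulmx_scalarC (regX
  K) GG')).
rewrite -mulmxA GG' mul_mx_scalar.
apply: completable_scaleW; first exact: powersX.
have [_ /powersP[m ->] [w vw]] := uv.
have uw : u *m (Gam *m w) = ('X^(c + m))%:M.
  by rewrite mulmxA -vE -scalemxAl vw scale_scalar_mx exprD.
have [|y uy] := @unit_f1 (u 0 0)`_0.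
  have /rowP/(_ 0) := fu; rewrite !mxE eqxx => /(congr1 (fun p : {poly k}
    => p`_0)).
  by rewrite coef_map coef1.
apply: (@completable_subset _ (powers 1)).
  by move=> s; rewrite powers1 => /eqP ->; apply: rpred1.
apply: cpoly; apply: unimodular_comax uw _.
pose q := u 0 0 * y%:P; exists (y%:P *: delta_mx 0 0), (- drop_poly 1 q).
rewrite -scalemxAr -colE; apply/rowP=> j; rewrite [j]ord1 !mxE mulr1n.
apply/polyP=> i; rewrite coefB coef1 coefXM coefN coef_drop_poly mulrC -/q.
case: i => [|i]; last by rewrite add0r opprK addn1.
by rewrite subr0 coefMC uy.
Qed.

End Horrocks.

(** * Approximating power series by polynomials *)

Section Approximation.
Variable R : comNzRingType.
Local Notation ps := (powerseries R).
Local Notation t := (psX R).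
Local Notation ofp := (@ps_of_poly R).
Local Notation comonic := (@comonic R).

Lemma psmx_split m n B (X : 'M[ps]_(m, n)) :
  X = map_mx ofp (map_mx (pstrunc B) X) + t ^+ B *: map_mx (psdrop B) X.
Proof. by apply/matrixP=> i j; rewrite !mxE -pstruncK. Qed.

Lemma ps1_mx_inv n (Z : 'M[ps]_n) : exists T', (1%:M - t *: Z) *m T' = 1%:M.
Proof.
apply: (mx_inv_lift (@psunit1 R)).
by rewrite map_mxB map_mx1 map_scalemx -[X in X *: _]/(psconst t) psconstX
  scale0r subr0.
Qed.

Lemma completable_approx n (V U : 'rV[ps]_n.+1) (W : 'cV_n.+1) V' M :
  V *m W = (t ^+ M)%:M -> V = map_mx ofp V' + t ^+ M.+1 *: U ->
  completable (powers t) (map_mx ofp V') -> completable (powers t) V.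
Proof.
move=> VW VE; have [T' TT'] := ps1_mx_inv (W *m U).
suff -> : map_mx ofp V' = V *m (1%:M - t *: (W *m U)).
  apply: completable_mul (@GRing.lreg1 _) _ TT'; exact: rpred1.
rewrite mulmxBr mulmx1 -scalemxAr mulmxA VW mul_scalar_mx scalerA -exprS.
by apply/eqP; rewrite eq_sym subr_eq -VE.
Qed.

Lemma unimodular_approx n (V U : 'rV[ps]_n.+1) (W : 'cV_n.+1) V' M :
  V *m W = (t ^+ M)%:M -> V = map_mx ofp V' + t ^+ M.+1 *: U ->
  exists W' q, V' *m W' = ('X^M * (1 + 'X * q))%:M.
Proof.
move=> VW VE; pose W' := map_mx (pstrunc M.+1) W; exists W'.
have [Z e] : exists Z, ofp ((V' *m W') 0 0) = t ^+ M + t ^+ M.+1 * Z.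
  pose D := map_mx (psdrop M.+1) W.
  exists (- (map_mx ofp V' *m D + U *m W) 0 0).
  have : map_mx ofp V' *m map_mx ofp W' =
         (t ^+ M)%:M - t ^+ M.+1 *: (map_mx ofp V' *m D + U *m W).
    rewrite -VW [V in RHS]VE mulmxDl {1}[W in RHS](psmx_split M.+1) -/W' -/D.
    by rewrite mulmxDr -scalemxAl -scalemxAr -[X in X - _]addrA -scalerDr addrK.
  rewrite -map_mxM => /matrixP/(_ 0 0); rewrite [LHS]mxE => ->.
  by rewrite !mxE mulr1n mulrN.
exists (drop_poly M.+1 ((V' *m W') 0 0));
  rewrite -comonicE -?mx11_scalar // => [|i lt_iM].
  transitivity (pscoef (ofp ((V' *m W') 0 0)) M) => //.
  rewrite e pscoefD pscoefXnM ltnSn addr0 -[t ^+ M]mulr1 pscoefXnM ltnn subnn.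
  by [].
transitivity (pscoef (ofp ((V' *m W') 0 0)) i) => //.
rewrite e pscoefD pscoefXnM ltnW // addr0 -[t ^+ M]mulr1 pscoefXnM lt_iM.
by [].
Qed.

Lemma ofp_comonic s : s \in comonic ->
  exists m x y, ofp s = t ^+ m * x /\ x * y = 1.
Proof.
move=> /asboolP[m [q ->]]; have [|y xy] := @psunit1 R (ofp (1 + 'X * q)).
  by rewrite /psconst /= coefD coef1 coefXM addr0.
by exists m, (ofp (1 + 'X * q)), y; rewrite rmorphM /= ps_of_polyXn.
Qed.

Lemma unimodular_comonic_ps n (v : 'rV[{poly R}]_n.+1) :
  unimodular comonic v -> unimodular (powers t) (map_mx ofp v).
Proof.
move=> [s /ofp_comonic[m [x [y [se xy]]]] [w vw]].
exists (t ^+ m); first exact: powersX.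
exists (y *: map_mx ofp w); rewrite -scalemxAr -map_mxM vw map_scalar_mx /= se.
by rewrite scale_scalar_mx mulrCA [y * x]mulrC xy mulr1.
Qed.

Lemma completable_comonic_ps n (v : 'rV[{poly R}]_n.+1) :
  completable comonic v -> completable (powers t) (map_mx ofp v).
Proof.
move=> [G [H [s [c [/ofp_comonic[m [x [y [se xy]]]]
                    /ofp_comonic[a [x' [y' [ce xy']]]] GH G0]]]]].
exists (y' *: map_mx ofp G), ((x' * y) *: map_mx ofp H), (t ^+ m), (t ^+ a).
split; rewrite ?powersX //.
  rewrite -scalemxAl -scalemxAr -map_mxM GH map_scalar_mx /= se.
  rewrite !scale_scalar_mx; congr _%:M.
  transitivity (t ^+ m * (x' * y') * (x * y)); first by ring.
  by rewrite xy xy' !mulr1.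
have -> : row 0 (y' *: map_mx ofp G) = y' *: row 0 (map_mx ofp G).
  by apply/rowP=> j; rewrite !mxE.
by rewrite -map_row G0 map_scalemx /= ce scalerA mulrCA [y' * _]mulrC xy' mulr1.
Qed.

Lemma comonic_to_laurent_series :
  rows_completable comonic -> rows_completable (powers t).
Proof.
move=> cc n V [_ /powersP[M ->] [W VW]]; have VE := psmx_split M.+1 V.
apply: (completable_approx VW VE); apply/completable_comonic_ps/cc.
have [W' [q e]] := unimodular_approx VW VE.
exists ('X^M * (1 + 'X * q)); last by exists W'.
by apply/asboolP; exists M, q.
Qed.

Lemma pstrunc_ofp B (p : {poly R}) : (size p <= B)%N -> pstrunc B (ofp p) = p.
Proof.
move=> sp; apply/polyP=> i; rewrite coef_poly; case: ltnP => // le.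
by rewrite nth_default // (leq_trans sp).
Qed.

Lemma laurent_series_to_comonic :
  rows_completable (powers t) -> rows_completable comonic.
Proof.
move=> cps n v /unimodular_comonic_ps/cps[G [H [s [c [/powersP[K
  ->] /powersP[a ->] GH G0]]]]].
have [D dv] := ex_deg_le v.
pose B := (K.+1 + (a + D.+1))%N.
pose G' := map_mx (pstrunc B) G.
have G'0 : row 0 G' = 'X^a *: v.
  apply/rowP=> j; have /rowP/(_ j) := G0; rewrite !mxE => ->.
  rewrite -ps_of_polyXn -rmorphM pstrunc_ofp //.
  rewrite (leq_trans (size_polyMleq _ _)) // size_polyXn addSn /=.
  by rewrite /B (leq_trans _ (leq_addl _ _)) // leq_add2l dv.
pose Z := t ^+ (a + D.+1) *: (H *m map_mx (psdrop B) G).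
have [T' TT'] := ps1_mx_inv Z.
have G'E : map_mx ofp G' = G *m (1%:M - t *: Z).
  rewrite mulmxBr mulmx1 /Z -!scalemxAr mulmxA GH mul_scalar_mx !scalerA -exprS.
  rewrite -exprD {1}[G in RHS](psmx_split B) -/G'.
  by rewrite (_ : _ + K = B)%N ?addrK // /B; lia.
have G'H : map_mx ofp G' *m (T' *m H) = (t ^+ K)%:M.
  by rewrite G'E mulmxA -(mulmxA G) TT' mulmx1 GH.
pose H' := map_mx (pstrunc K.+1) (T' *m H).
pose Q := map_mx (drop_poly K.+1) (G' *m H').
have G'H' : G' *m H' = 'X^K *: (1%:M + 'X *: Q).
  have e : map_mx ofp (G' *m H') = (t ^+ K)%:M
      - t ^+ K.+1 *: (map_mx ofp G' *m map_mx (psdrop K.+1) (T' *m H)).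
    rewrite -G'H [T' *m H in X in _ = X - _](psmx_split K.+1).
    by rewrite mulmxDr -scalemxAr addrK map_mxM.
  apply/matrixP=> i j; have /matrixP/(_ i j) := e.
  rewrite [LHS]mxE [RHS]mxE [X in _ = X + _]mxE.
  rewrite [X in _ = _ + X]mxE [X in _ = _ - X]mxE => eij.
  rewrite [RHS]mxE [X in _ * X]mxE [X in _ * (X + _)]mxE [X in _ * (_ + X)]mxE.
  apply/polyP=> l; rewrite coefXnM.
  have {}eij : ((G' *m H') i j)`_l = pscoef ((t ^+ K *+ (i == j)) - t ^+ K.+1 *
     (map_mx ofp G' *m map_mx (psdrop K.+1) (T' *m H)) i j) l.
    by rewrite -eij.
  have tK : pscoef (t ^+ K *+ (i == j)) l = ((i == j)%:R * (l == K)%:R).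
    rewrite -ps_of_polyXn; case: (i == j); rewrite ?mul0r // mul1r mulr1n.
    by rewrite /= coefXn.
  rewrite pscoefD pscoefN pscoefXnM tK in eij.
  case: (ltngtP l K) eij => [lt_lK|lt_Kl|->] eij.
  - by rewrite eij ltnW // mulr0 subr0.
  - rewrite coefD coefXM -polyC_natr coefC subn_eq0 leqNgt lt_Kl /= add0r [Q i
      j]mxE.
    by rewrite coef_drop_poly; congr _`_(_); lia.
  - by rewrite eij ltnSn subr0 mulr1 coefD -polyC_natr coefC subnn coefXM addr0.
pose d := \det (1%:M + 'X *: Q).
have d1 : d`_0 = 1.
  rewrite -horner_coef0 -[d.[0]]/(horner_eval 0 d) -det_map_mx.
  rewrite map_mxD map_mx1 map_scalemx /= /horner_eval hornerX scale0r addr0.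
  exact: det1.
exists G', (H' *m \adj (1%:M + 'X *: Q)), ('X^K * d), 'X^a; split=> //.
- apply/asboolP; exists K, (drop_poly 1 d); rewrite {1}[d](@comonicE R 0) //.
  by rewrite expr0 mul1r.
- by apply/asboolP; exists a, 0; rewrite mulr0 addr0 mulr1.
- by rewrite mulmxA G'H' -scalemxAl mul_mx_adj scale_scalar_mx.
Qed.

Lemma comonic_to_monic : rows_completable comonic ->
  rows_completable (@monic_pred R : {pred {poly R}}).
Proof.
move=> cc n v uv; have [D dv] := ex_deg_le v.
have -> : v = map_mx (revp D) (map_mx (revp D) v).
  by apply/rowP=> j; rewrite !mxE revpK.
apply: (completable_rev (S := comonic)).
- exact: revp_comonic.
- by move=> i j; rewrite mxE size_revp.
apply: cc; apply: unimodular_rev dv uv; exact: revp_monic.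
Qed.

Lemma monic_to_comonic : rows_completable (@monic_pred R : {pred {poly R}}) ->
  rows_completable comonic.
Proof.
move=> cc n v uv; have [D dv] := ex_deg_le v.
have -> : v = map_mx (revp D) (map_mx (revp D) v).
  by apply/rowP=> j; rewrite !mxE revpK.
apply: (completable_rev (S := @monic_pred R : {pred {poly R}})).
- exact: revp_monic.
- by move=> i j; rewrite mxE size_revp.
apply: cc; apply: unimodular_rev dv uv; exact: revp_comonic.
Qed.

End Approximation.

Section PolynomialModel.
Variables (R : comNzRingType) (k : fieldType) (f : {rmorphism R -> k}).
Variable (g : k -> R).
Hypothesis gK : cancel g f.
Hypothesis unit_f : forall x, f x != 0 -> exists y, x * y = 1.
Local Notation ps := (powerseries R).
Local Notation t := (psX R).
Local Notation ofp := (@ps_of_poly R).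
Local Notation fp := (map_mx (map_poly f)).
Local Notation fps := (map_mx (psmap f)).

Lemma rmodp_map (a z : {poly R}) (z' : {poly k}) :
  a \is monic -> map_poly f z = z' -> (size z' < size a)%N ->
  map_poly f (Pdiv.CommonRing.rmodp z a) = z'.
Proof.
move=> mon_a fz sz'; have := Pdiv.RingMonic.rdivp_eq mon_a z.
move=> /(congr1 (map_poly f)); rewrite fz rmorphD rmorphM => e.
have sa : size (map_poly f a) = size a.
  by rewrite size_map_poly_id0 // (monicP mon_a) rmorph1 oner_eq0.
rewrite -(modp_small (p := z') (q := map_poly f a)) ?sa // e.
rewrite modp_addl_mul_small // sa; apply: leq_ltn_trans (size_poly _ _) _.
by rewrite Pdiv.CommonRing.ltn_rmodp monic_neq0.
Qed.

Lemma unimodular_powersX n (V : 'rV[{poly R}]_n.+1) W M (q : {poly R})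
    (h : 'cV_n.+1) e (y : {poly R}) :
  V 0 0 \is monic -> (1 < size (V ord0 ord0))%N -> V *m W = ('X^M * (1
    + 'X * q))%:M ->
  V *m h = ('X^e + y)%:M -> map_poly f y = 0 ->
  unimodular (powers 'X) V.
Proof.
move=> monV sV VW Vh fy; set a := V 0 0 in monV sV; pose B := (size a).-1.
have B0 : (size a) = B.+1 by rewrite prednK // size_poly_gt0 monic_neq0.
pose I (x : {poly R}^o) := exists w : 'cV_n.+1, V *m w = x%:M.
have I0 : I 0 by exists 0; rewrite mulmx0 raddf0.
have ID x z : I x -> I z -> I (x + z).
  by move=> [u ux] [v vz]; exists (u + v); rewrite mulmxDr ux vz raddfD.
have IM c x : I x -> I (c * x).
  by move=> [u ux]; exists (c *: u); rewrite -scalemxAr ux scale_scalar_mx.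
have Ia : I a.
  by exists (delta_mx 0 0); rewrite -colE; apply/rowP=> j;
    rewrite [j]ord1 !mxE mulr1n.
have IW : I ('X^M * (1 + 'X * q)) by exists W.
have Ih : I ('X^e + y) by exists h.
have qe : exists z, (- q) ^+ e * 'X^e = 1 + (1 + 'X * q) * z.
  exists (- \sum_(i < e) (- ('X * q)) ^+ i).
  rewrite -exprMn mulNr [q * _]mulrC -[LHS](subrK 1) subrX1 mulrN -mulNr.
  by rewrite opprD addrC [- 1 - _]addrC.
pose z i : {poly R} := 'X^i + (- q) ^+ e * 'X^i * y.
have Iz i : I ('X^M * z i).
  have [c ce] := qe; have -> : 'X^M * z i = ((- q) ^+ e * 'X^M * 'X^i) * ('X^e
    + y)
    + (- c * 'X^i) * ('X^M * (1 + 'X * q)).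
    rewrite /z; transitivity ('X^M * 'X^i * ((1 + (1 + 'X * q) * c) +
      (- q) ^+ e * y - (1 + 'X * q) * c)); first by ring.
    by rewrite -ce; ring.
  by apply: ID; apply: IM.
have fz i : map_poly f (z i) = 'X^i.
  by rewrite rmorphD rmorphM /= fy mulr0 addr0 map_polyXn.
pose r i := Pdiv.CommonRing.rmodp (z i) a.
have Ir i : I ('X^M * r i).
  have := Pdiv.RingMonic.rdivp_eq monV (z i); rewrite -/(r i) => ze.
  have -> : 'X^M * r i = 'X^M * z i + (- 'X^M * Pdiv.CommonRing.rdivp (z i) a)
    * a.
    by rewrite {1}ze; ring.
  by apply: ID => //; apply: IM.
have sr i : (size (r i) <= B)%N by rewrite -ltnS -B0 Pdiv.CommonRing.ltn_rmodp
  monic_neq0.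
pose b (i : 'I_B) : {poly R}^o := 'X^M * 'X^i.
have Ib : forall i, I (b i).
  have IZ c x : I x -> I (c%:P *: x) by apply: IM.
  apply: (@nakayama _ _ f (unit_f1 unit_f) _ polyC {poly R}^o I I0 ID IZ _ b
           (fun i j : 'I_B => (r i)`_j)).
  - move=> i j; have /(congr1 (fun p : {poly k}
      => p`_j)) : map_poly f (r i) = 'X^i.
      by apply: rmodp_map => //; rewrite size_polyXn B0 ltnS.
    by rewrite coef_map coefXn eq_sym.
  - move=> i; have -> : \sum_(j < B) ((r i)`_j)%:P *: b j = 'X^M * r i :> {poly
      R}.
      rewrite [in RHS](poly_sumXn (sr i)) mulr_sumr; apply: eq_bigr => j _.
      by rewrite -mul_polyC mulrCA.
    exact: Ir.
have B1 : (0 < B)%N by rewrite -ltnS -B0.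
have [w Vw] := Ib (Ordinal B1).
exists 'X^M; first exact: powersX.
by exists w; rewrite Vw /b expr0 mulr1.
Qed.

(* Adding ['X^(M+1+e)] and ['X^(M+1)] to the first two entries makes the first
   one monic and puts ['X^e] in the ideal of the entries modulo the maximal
   ideal. *)
Lemma polynomial_model n (V : 'rV[ps]_n.+2) W M e :
  V *m W = (t ^+ M)%:M -> fps V = psX k ^+ e *: delta_mx 0 0 -> (e <= M)%N ->
  exists (V' : 'rV[{poly R}]_n.+2) U B,
    [/\ V = map_mx ofp V' + t ^+ M.+1 *: U, unimodular (powers 'X) V',
        deg_le B V' & (V' 0 0)`_B = 1].
Proof.
move=> VW fV le_eM; pose j1 : 'I_n.+2 := lift 0 0.
pose E0 : 'rV[{poly R}]_n.+2 := 'X^e *: delta_mx 0 0 + delta_mx 0 j1.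
pose V1 := map_mx (pstrunc M.+1) V.
pose V' := V1 + 'X^(M.+1) *: E0.
have VE : V = map_mx ofp V' + t ^+ M.+1 *: (map_mx (psdrop M.+1) V - map_mx ofp
  E0).
  rewrite map_mxD map_scalemx /= ps_of_polyXn scalerBr addrACA subrr addr0.
  exact: psmx_split.
have E00 : E0 0 0 = 'X^e by rewrite !mxE eqxx mulr1 addr0.
have E01 : E0 0 j1 = 1 by rewrite !mxE !eqxx mulr0 add0r.
have sV1 j : (size (V1 0%R j) <= M.+1)%N by rewrite mxE size_poly.
have V'E j : V' 0 j = V1 0 j + 'X^(M.+1) * E0 0 j by rewrite mxE [X in _
  + X]mxE.
have dE0 : deg_le e E0.
  move=> i j; rewrite [i]ord1 !mxE; case: (j == 0); case: (j == j1);
    rewrite ?andbF ?andbT ?mulr0 ?mulr1 ?addr0 ?add0r ?size_poly0 ?size_poly1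
      //.
  - by rewrite (leq_trans (size_polyD _ _)) // size_polyXn size_poly1 geq_max
      leqnn.
  - by rewrite size_polyXn.
have fV1 j : map_poly f (V1 0 j) = 'X^e *+ (j == 0).
  rewrite mxE; have -> p : map_poly f (pstrunc M.+1 p) = pstrunc M.+1 (psmap f
    p).
    apply/polyP=> i; rewrite coef_map /= [X in f X]coef_poly coef_poly.
    by case: ifP; rewrite ?raddf0.
  have /rowP/(_ j) := fV; rewrite mxE [RHS]mxE [X in _ * X]mxE => ->.
  rewrite -ps_of_polyXn mulr_natr -raddfMn pstrunc_ofp //.
  by case: (j == 0); rewrite ?mulr1n ?mulr0n ?size_polyXn ?size_poly0.
clearbody E0 V1.
pose B := (M.+1 + e)%N.
have dV' : deg_le B V'.
  move=> i j; rewrite [i]ord1 V'E (leq_trans (size_polyD _ _)) // geq_max.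
  apply/andP; split.
    by apply: leq_trans (sV1 j) _; rewrite /B -addnS leq_addr.
  apply: leq_trans (size_polyMleq _ _) _; rewrite size_polyXn addSn.
  by have := dE0 0 j; rewrite /B; move: (size _) => sz; lia.
have V'B : (V' 0 0)`_B = 1.
  rewrite V'E coefD nth_default ?(leq_trans (sV1 0)) ?leq_addr // add0r E00.
  by rewrite -exprD coefXn eqxx.
have sV' : size (V' 0 0) = B.+1.
  apply/eqP; rewrite eqn_leq dV' /=; apply: contraT; rewrite -leqNgt.
  by move=> /leq_sizeP/(_ B (leqnn _)) /eqP; rewrite V'B oner_eq0.
have monV' : V' 0 0 \is monic by rewrite monicE lead_coefE sV' V'B.
exists V', (map_mx (psdrop M.+1) V - map_mx ofp E0), B; split=> //.
have [W' [q V'W']] := unimodular_approx VW VE.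
apply: (@unimodular_powersX _ V' W' M q (delta_mx 0 0 - 'X^e *: delta_mx j1 0) e
         (V1 0 0 - 'X^e * V1 0 j1 - 'X^e)) => //.
- by rewrite sV'.
- rewrite mulmxBr -scalemxAr -!colE; apply/rowP=> j.
  rewrite [j]ord1 [LHS]mxE [X in X + _]mxE [X in _ + X]mxE [X in - X]mxE.
  rewrite [X in _ * X]mxE [RHS]mxE mulr1n !V'E E00 E01; ring.
- by rewrite !rmorphB rmorphM /= !fV1 map_polyXn mulr1n mulr0 subr0 subrr.
Qed.

Lemma completable_by_model :
  (forall n (V : 'rV[{poly R}]_n.+1) B, unimodular (powers 'X) V ->
     deg_le B V -> (V 0 0)`_B = 1 -> completable (powers 'X) V) ->
  rows_completable (powers t).
Proof.
move=> cmodel [|n] V0 uV0; first exact: completable1.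
have [_ /powersP[M ->] [W0 VW0]] := uV0.
have fVW0 : fps V0 *m fps W0 = (psX k ^+ M)%:M.
  by rewrite -map_mxM VW0 map_scalar_mx /= psmapXn.
have [T [T' [e [le_eM TT' fVT]]]] := psrow_pivot gK unit_f fVW0.
apply: (completable_mul (@GRing.lreg1 _) (rpred1 _) TT').
have VW : V0 *m T *m (T' *m W0) = (t ^+ M)%:M.
  by rewrite mulmxA -(mulmxA V0) TT' mulmx1.
rewrite -map_mxM in fVT.
have [V' [U [B [VE uV' dV' V'B]]]] := polynomial_model VW fVT le_eM.
apply: (completable_approx VW VE); apply: completable_map (cmodel _ _ _ uV' dV'
  V'B).
by move=> _ /powersP[i ->]; rewrite /= ps_of_polyXn powersX.
Qed.

Lemma laurent_poly_to_laurent_series :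
  rows_completable (powers ('X : {poly R})) -> rows_completable (powers t).
Proof. by move=> cX; apply: completable_by_model => n V B uV _ _;
  apply: cX. Qed.

Lemma poly_to_laurent_series :
  rows_completable (powers (1 : {poly R})) -> rows_completable (powers t).
Proof.
move=> c1; apply: completable_by_model => n V B uV dV VB.
pose V' := map_mx (revp B) V.
have -> : V = map_mx (revp B) V' by apply/rowP=> j; rewrite !mxE revpK.
apply: (completable_rev (@revp_powers1 R)).
  by move=> i j; rewrite mxE size_revp.
have [_ /powersP[L ->] [w V'w]] : unimodular (powers 'X) V'.
  by apply: unimodular_rev uV; first exact: revp_powersX.
apply: c1; apply: unimodular_comax V'w _.
exists (delta_mx 0 0), (- drop_poly 1 (V' 0 0)).
rewrite -colE; apply/rowP=> j; rewrite [j]ord1 [LHS]mxE [RHS]mxE mulr1n mulrN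
  opprK.
by rewrite {1}[V' 0 0](@comonicE R 0) ?expr0 ?mul1r // mxE coef_poly subn0.
Qed.

End PolynomialModel.

(** * Stably free modules and unimodular rows *)

Section LocalizationRows.
Variables (A : comPzRingType) (S : mulrClosed A).
Hypothesis regS : forall s, s \in S -> GRing.lreg s.
Local Notation L := (localization S).
Local Notation io := (to_loc S).

Lemma to_loc_mx_inj m n (X Y : 'M[A]_(m, n)) :
  map_mx io X = map_mx io Y -> X = Y.
Proof.
move=> e; apply/matrixP=> i j; have /matrixP/(_ i j) := e; rewrite !mxE.
by move=> /Localization.to_loc_eq[u uS /(regS uS)].
Qed.

Lemma common_denominator m n (X : 'M[L]_(m, n)) :
  exists s Y, s \in S /\ io s *: X = map_mx io Y.
Proof.
have /choice[as_ asP] (p : 'I_m * 'I_n) : exists as_ : A * A,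
    as_.2 \in S /\ X p.1 p.2 * io as_.2 = io as_.1.
  by have [a [s [sS e]]] := Localization.to_loc_surj (X p.1 p.2); exists (a, s).
exists (\prod_p (as_ p).2), (\matrix_(i, j) ((as_ (i, j)).1 *
  \prod_(q | q != (i, j)) (as_ q).2)); split.
  by apply: rpred_prod => p _; have [] := asP p.
apply/matrixP=> i j; rewrite !mxE (bigD1 (i, j)) //= !rmorphM /=.
by have [_ /= <-] := asP (i, j); rewrite mulrAC [io _ * _]mulrC.
Qed.

Lemma rows_completable_localization :
  rows_completable (powers (1 : L)) <-> rows_completable S.
Proof.
split=> cc n v.
  move=> [s sS [w vw]]; have [si ssi] := Localization.to_loc_unit sS.
  have [|G [H [s1 [c []]]]] := cc n (map_mx io v).
    exists 1; first by rewrite rpred1.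
    exists (si *: map_mx io w); rewrite -scalemxAr -map_mxM vw map_scalar_mx.
    by rewrite scale_scalar_mx mulrC ssi.
  rewrite !powers1 => /eqP -> /eqP -> GH G0.
  have [g [G' [gS GE]]] := common_denominator G.
  have [h [H' [hS HE]]] := common_denominator H.
  exists G', H', (g * h), g; split; rewrite ?rpredM //.
    apply: to_loc_mx_inj; rewrite map_mxM -GE -HE -scalemxAl -scalemxAr GH.
    by rewrite map_scalar_mx rmorphM !scale_scalar_mx mulr1.
  apply: to_loc_mx_inj; rewrite map_row -GE map_scalemx.
  rewrite -[map_mx _ v]scale1r -G0.
  by apply/rowP=> j; rewrite !mxE.
move=> [_ /[1!powers1] /eqP -> [w vw]].
have [s [v' [sS vE]]] := common_denominator v.
have [r [w' [rS wE]]] := common_denominator w.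
have [|G [H [d [c [dS cS GH G0]]]]] := cc n v'.
  exists (s * r); rewrite ?rpredM //; exists w'; apply: to_loc_mx_inj.
  rewrite map_mxM -vE -wE -scalemxAl -scalemxAr vw map_scalar_mx rmorphM.
  by rewrite !scale_scalar_mx mulr1.
have [di ddi] := Localization.to_loc_unit dS.
have csS : c * s \in S by rewrite rpredM.
have [z csz] := Localization.to_loc_unit csS.
exists (z *: map_mx io G), ((io (c * s) * di) *: map_mx io H), 1, 1.
rewrite rpred1; split=> //.
  rewrite -scalemxAl -scalemxAr -map_mxM GH map_scalar_mx !scale_scalar_mx /=.
  by rewrite -mulrA [di * _]mulrC ddi mulr1 mulrC csz.
have -> : row 0 (z *: map_mx io G) = z *: row 0 (map_mx io G).
  by apply/rowP=> j; rewrite !mxE.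
rewrite -map_row G0 map_scalemx -vE scale1r !scalerA -mulrA -rmorphM /=.
by rewrite mulrC csz scale1r.
Qed.

End LocalizationRows.

Lemma to_linear (A : pzRingType) (U V : lmodType A) (F : U -> V) :
  linear F -> exists L : {linear U -> V}, L =1 F.
Proof.
move=> linF; pose mF := GRing.isLinear.Build A U V _ F linF.
by exists (HB.pack F mF : {linear U -> V}).
Qed.

Section Kernel.
Variables (A : comPzRingType) (n : nat) (v : 'cV[A]_n).

Definition kerpred : {pred 'rV[A]_n} := [pred x | x *m v == 0].

Lemma kerpred_submod_closed : submod_closed kerpred.
Proof.
split=> [|a x y /eqP ex /eqP ey]; first by rewrite inE mul0mx.
by rewrite inE mulmxDl -scalemxAl ex ey scaler0 addr0.
Qed.

HB.instance Definition _ :=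
  GRing.isSubmodClosed.Build A 'rV[A]_n kerpred kerpred_submod_closed.

Record kermod := Kermod { kerval : 'rV[A]_n; _ : kerval \in kerpred }.

HB.instance Definition _ := [isSub for kerval].
HB.instance Definition _ := [Choice of kermod by <:].
HB.instance Definition _ := [SubChoice_isSubLmodule of kermod by <:].

End Kernel.

Section FreeModules.
Variable A : comPzRingType.

Lemma free_finite_basis (P : lmodType A) : fin_gen P -> free_module P ->
  exists r (b : 'I_r -> P),
    (forall c : 'I_r -> A, \sum_i c i *: b i = 0 -> forall i, c i = 0) /\
    (forall x, exists c : 'I_r -> A, x = \sum_i c i *: b i).
Proof.
move=> [n [q qP]] [B [indB spanB]].
have /choice[sc scP] i : exists sc : seq P * (P -> A),
    (forall b, b \in sc.1 -> B b) /\ q i = \sum_(b <- sc.1) sc.2 b *: b.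
  by have [s [c]] := spanB (q i); exists (s, c).
pose s := undup (flatten [seq (sc i).1 | i <- enum 'I_n]).
have us : uniq s by apply: undup_uniq.
have sB b : b \in s -> B b.
  rewrite mem_undup => /flattenP[_ /mapP[i _ ->]] bi.
  by have [sB _] := scP i; apply: sB.
pose D x := exists d : P -> A, x = \sum_(b <- s) d b *: b.
have DD x y : D x -> D y -> D (x + y).
  move=> [d ->] [e ->]; exists (fun b => d b + e b); rewrite -big_split.
  by apply: eq_bigr => b _; rewrite scalerDl.
have DZ c x : D x -> D (c *: x).
  move=> [d ->]; exists (fun b => c * d b); rewrite scaler_sumr.
  by apply: eq_bigr => b _; rewrite scalerA.
have D0 : D 0 by exists (fun=> 0); rewrite big1 // => b _; rewrite scale0r.
have Db b : b \in s -> D b.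
  move=> bs; exists (fun b' => (b' == b)%:R); rewrite (bigD1_seq b) //= eqxx.
  by rewrite scale1r big1 ?addr0 // => b' /negPf ->; rewrite scale0r.
have Dx x : D x.
  have [c ->] := qP x; elim/big_ind: _ => // i _; apply: (DZ).
  have [_ ->] := scP i; rewrite big_seq; elim/big_ind: _ => // b bi.
  apply/DZ/Db; rewrite mem_undup; apply/flattenP; exists (sc i).1 => //.
  by apply: map_f; rewrite mem_enum.
exists (size s), (fun i => nth 0 s i); split=> [c c0 i|x]; last first.
  have [d ->] := Dx x; exists (fun i => d (nth 0 s i)).
  by rewrite (big_nth 0) big_mkord.
pose c' b := if insub (index b s) is Some j then c j else 0.
have c'E (j : 'I_(size s)) : c' (nth 0 s j) = c j.
  by rewrite /c' index_uniq // insubT //= => p; congr c; apply: val_inj.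
rewrite -c'E; apply: (indB s) => //; last exact: mem_nth.
rewrite (big_nth 0) big_mkord -[RHS]c0.
by apply: eq_bigr => j _; rewrite c'E.
Qed.

Lemma row_completion_of_basis n (v : 'rV[A]_n.+1) r (M : 'M[A]_(1 + r, n.+1))
    (N : 'M_(n.+1, 1 + r)) :
  1 != 0 :> A -> M *m N = 1%:M -> N *m M = 1%:M ->
  M *m v^T = delta_mx 0 0 -> completable (powers 1) v.
Proof.
move=> A1 MN NM Mv.
pose nzA : comNzRingType := HB.pack A (GRing.PzSemiRing_isNonZero.Build A A1).
have e1 := @mulmx1_min nzA _ _ M N MN; have e2 := @mulmx1_min nzA _ _ N M NM.
have er : r = n by lia.
move: M N MN NM Mv {e1 e2}; rewrite er => M N MN NM Mv {r er}.
exists N^T, M^T, 1, 1; rewrite rpred1 -trmx_mul MN trmx1 scale1r; split=> //.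
have vE : v^T = col 0 N by rewrite colE -Mv mulmxA NM mul1mx.
by rewrite -[RHS]trmxK vE tr_col.
Qed.

Lemma Hermite_rows_completable : Hermite A -> rows_completable (powers (1 : A)).
Proof.
move=> hA n v [_ /[1!powers1] /eqP -> [w vw]].
have [A1|A1] := eqVneq (1 : A) 0.
  have all0 (x : A) : x = 0 by rewrite -[x]mul1r A1 mul0r.
  exists 1%:M, 1%:M, 1, 1; rewrite rpred1; split=> //; first by rewrite mulmx1.
  by apply/rowP=> j; apply: etrans (all0 _) (esym (all0 _)).
pose P : lmodType A := kermod v^T.
have kv (p : P) : kerval p *m v^T = 0 by apply/eqP; case: p.
have wv : w^T *m v^T = 1%:M by rewrite -trmx_mul vw trmx1.
pose pr (x : 'rV[A]_n.+1) := x - (x *m v^T) *m w^T.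
have prK x : pr x \in kerpred v^T.
  by rewrite inE mulmxBl -(mulmxA _ w^T) wv mulmx1 subrr.
pose q i : P := Kermod (prK (delta_mx 0 i)).
have kvD (x y : P) : kerval (x + y) = kerval x + kerval y by [].
have kvZ c (x : P) : kerval (c *: x) = c *: kerval x by [].
have kv0 : kerval (0 : P) = 0 by [].
have kv_sum (F : 'I_n.+1 -> P) : kerval (\sum_i F i) = \sum_i kerval (F i).
  exact: (big_morph _ kvD kv0).
have kv_inj : injective (@kerval _ _ v^T) by apply: val_inj.
have qE (x : P) : x = \sum_i kerval x 0 i *: q i.
  apply: kv_inj; rewrite kv_sum; under eq_bigr do rewrite kvZ /= /pr scalerBr.
  rewrite big_split -row_sum_delta sumrN /=.
  under eq_bigr do rewrite !scalemxAl.
  by rewrite -!mulmx_suml -row_sum_delta kv mul0mx subr0.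
have fgP : fin_gen P by exists n.+1, q => x; exists (fun i => kerval x 0 i).
have projP : projective P.
  move=> M N g f surj_g; have /choice[m mP] i := surj_g (f (q i)).
  have [|h hE] := @to_linear A P M (fun x => \sum_i kerval x 0 i *: m i).
    move=> c x y; rewrite scaler_sumr -big_split; apply: eq_bigr => i _ /=.
    rewrite scalerA -scalerDl; congr (_ *: _).
    by transitivity ((c *: kerval x + kerval y) 0 i); last rewrite !mxE.
  exists h => x; rewrite hE linear_sum [in RHS](qE x) linear_sum.
  by apply: eq_bigr => i _; rewrite !linearZ /= mP.
have sfP : stably_free P.
  exists 1, n.+1; pose F (x : P * 'rV[A]_1) := kerval x.1 + x.2 *m w^T.
  have [|L LE] := @to_linear A _ _ F.
    move=> c [x a] [y b].
    transitivity (c *: kerval x + kerval y + (c *: a + b) *m w^T) => //.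
    by rewrite /F mulmxDl -scalemxAl scalerDr addrACA.
  exists L; exists (fun y => (Kermod (prK y), y *m v^T)) => [[x a]|y].
    rewrite LE /F /=; have e : (kerval x + a *m w^T) *m v^T = a.
      by rewrite mulmxDl kv add0r -mulmxA wv mulmx1.
    congr (_, _) => //; apply: kv_inj; rewrite /= /pr e addrK //.
  by rewrite LE /F /= /pr subrK.
have [r [b [indb spanb]]] := free_finite_basis fgP (hA P fgP projP sfP).
pose Mb := \matrix_i kerval (b i).
pose M : 'M_(1 + r, n.+1) := col_mx w^T Mb.
have MbE (c : 'rV[A]_r) : c *m Mb = \sum_i c 0 i *: kerval (b i).
  by rewrite mulmx_sum_row; apply: eq_bigr => i _; rewrite rowK.
have kv_sumr (c : 'I_r -> A) : kerval (\sum_i c i *: b i) = \sum_i c i *: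
  kerval (b i).
  exact: (big_morph _ kvD kv0).
have Mbv : Mb *m v^T = 0.
  by apply/row_matrixP=> i; rewrite row_mul rowK kv row0.
have Mv : M *m v^T = delta_mx 0 0.
  rewrite mul_col_mx wv Mbv; apply/matrixP=> i j; rewrite mxE [RHS]mxE [j]ord1.
  by case: split_ordP => l ->; rewrite !mxE ?[l]ord1.
have /choice[N NP] i : exists y : 'rV_(1 + r), y *m M = row i (1%:M : 'M_n.+1).
  have [c cE] := spanb (q i).
  exists (row_mx (row i 1%:M *m v^T) (\row_j c j)).
  rewrite mul_row_col MbE.
  under eq_bigr do rewrite mxE.
  by rewrite -kv_sumr -cE /= /pr row1 addrC subrK.
pose Nm := \matrix_i N i.
have NM : Nm *m M = 1%:M by apply/row_matrixP=> i; rewrite row_mul rowK NP.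
have injM (y : 'rV_(1 + r)) : y *m M = 0 -> y = 0.
  rewrite -[y]hsubmxK mul_row_col => yM.
  have y1 : lsubmx y = 0.
    have := congr1 (fun X => X *m v^T) yM; rewrite mul0mx mulmxDl -!mulmxA.
    by rewrite wv Mbv mulmx1 mulmx0 addr0.
  move: yM; rewrite y1 mul0mx add0r MbE -kv_sumr => y2.
  have {}y2 : \sum_i rsubmx y 0 i *: b i = 0 by apply: kv_inj.
  rewrite (_ : rsubmx y = 0) ?row_mx0 //.
  by apply/rowP=> i; rewrite [RHS]mxE; apply: (indb (fun i => rsubmx y 0 i)).
have MN : M *m Nm = 1%:M.
  apply/eqP; rewrite -subr_eq0; apply/eqP/row_matrixP=> i; rewrite row0.
  by apply: injM; rewrite -row_mul mulmxBl -mulmxA NM mulmx1 mul1mx subrr row0.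
exact: (row_completion_of_basis A1 MN NM Mv).
Qed.

End FreeModules.

Section HermiteRows.
Variable A : comPzRingType.

Lemma rsubmx_delta00 n (c : A) (x : 'rV[A]_(1 + n)) :
  rsubmx (c *: delta_mx 0 0 + x : 'rV_(1 + n)) = rsubmx x.
Proof. by apply/rowP=> j; rewrite !mxE andbF mulr0 add0r. Qed.

Lemma row_mx0_rsubmx n (x : 'rV[A]_(1 + n)) :
  row_mx 0 (rsubmx x) = - x 0 0 *: delta_mx 0 0 + x :> 'rV_(1 + n).
Proof.
rewrite scale_delta00; set a := x 0 0; rewrite [x in _ + x]row_mx_head -/a.
apply: etrans (esym (add_row_mx _ _ _ _));
  by rewrite add0r -raddfD addNr raddf0.
Qed.

Lemma free_module_row (P : lmodType A) N :
  lmod_iso (P * 'rV[A]_0)%type 'rV[A]_N -> free_module P.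
Proof.
move=> [F [F' FK F'K]].
have /to_linear[h hE] : linear (fun x : P => F (x, 0)).
  move=> c x y; rewrite -linearP; congr (F _).
  rewrite [RHS]surjective_pairing; congr (_, _).
  by rewrite [LHS]thinmx0 [RHS]thinmx0.
pose h' y := (F' y).1.
have h'K y : h (h' y) = y.
  by rewrite hE -[RHS]F'K /h'; case: (F' y) => x z; rewrite [z]thinmx0.
have hK x : h' (h x) = x by rewrite hE /h' FK.
exists (fun b => exists i, h b = delta_mx 0 i); split=> [s c us sB c0 b bs|x].
  have [i hb] := sB b bs; have /rowP/(_ i) := congr1 h c0.
  rewrite linear0 linear_sum summxE [RHS]mxE (bigD1_seq b) //= linearZ /= hb.
  rewrite !mxE !eqxx mulr1 big_seq_cond big1 ?addr0 // => b' /andP[b's ne].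
  have [j hb'] := sB b' b's; rewrite linearZ /= hb' !mxE eqxx.
  case: eqP => [e|]; last by rewrite mulr0.
  by move/eqP: ne; case; rewrite -[b']hK -[b]hK hb hb' e.
exists [seq h' (delta_mx 0 i) | i <- enum 'I_N], (fun b
  => (h b *m (h x)^T) 0 0).
split=> [b /mapP[i _ ->]|]; first by exists i; rewrite h'K.
rewrite big_map big_enum /=; apply: (can_inj hK); rewrite linear_sum.
rewrite [LHS]row_sum_delta; apply: eq_bigr => i _.
by rewrite linearZ /= h'K -rowE !mxE.
Qed.

Lemma rows_completable_cancel (P : lmodType A) m N :
  rows_completable (powers (1 : A)) -> 1 != 0 :> A ->
  lmod_iso (P * 'rV[A]_m.+1)%type 'rV[A]_N ->
  exists N', lmod_iso (P * 'rV[A]_m)%type 'rV[A]_N'.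
Proof.
move=> cA A1 [F [F' FK F'K]].
have F'lin c x y : F' (c *: x + y) = c *: F' x + F' y.
  by apply: (can_inj FK); rewrite F'K linearP !F'K.
have [F'L F'LE] := to_linear F'lin.
pose w := F (0, delta_mx 0 0).
pose v : 'cV_N := \col_i (F' (delta_mx 0 i)).2 0 0.
have F'v x : (F' x).2 0 0 = (x *m v) 0 0.
  rewrite -F'LE {1}[x]row_sum_delta linear_sum mxE.
  have -> (G : 'I_N -> P * 'rV[A]_m.+1) : (\sum_i G i).2 = \sum_i (G i).2.
    exact: (big_morph snd).
  rewrite summxE; apply: eq_bigr => i _.
  by rewrite linearZ /= F'LE !mxE.
have wE : w = F (0, delta_mx 0 0) by [].
have wv : w *m v = 1%:M.
  by apply/matrixP=> i j; rewrite [i]ord1 [j]ord1 -F'v FK !mxE.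
clearbody w v; clear F'L F'LE.
move: F F' FK F'K F'lin w v F'v wE wv.
case: N => [|n] F F' FK F'K F'lin w v F'v wE wv.
  have := congr1 (fun X : 'M_1 => X 0 0) wv; rewrite !mxE big_ord0 => /esym/eqP.
  by rewrite (negPf A1).
have [|G [H [s [c []]]]] := cA n w.
  by exists 1; [rewrite rpred1 | exists v].
rewrite !powers1 => /eqP -> /eqP -> GH; rewrite scale1r => G0.
have HG := mulmx1C GH.
have wH : w *m H = delta_mx 0 0 by rewrite -G0 -row_mul GH row1.
exists n.
pose Phi (x : P * 'rV[A]_m) : 'rV_n := rsubmx (F (x.1, row_mx 0 x.2 : 'rV_(1
  + m)) *m H : 'rV_(1 + n)).
pose Psi (y : 'rV_n) : P * 'rV[A]_m :=
  let z := F' ((row_mx 0 y : 'rV_(1 + n)) *m G) in (z.1, rsubmx (z.2 : 'rV_(1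
    + m))).
have pairE a (p q : P) (x y : 'rV[A]_m.+1) : F (a *: p + q, a *: x
  + y) = a *: F (p, x) + F (q, y).
  by rewrite -linearP.
have Phi_lin : linear Phi.
  move=> a [p x] [q y]; rewrite /Phi /=.
  have -> : row_mx 0 (a *: x + y) = a *: row_mx 0 x + row_mx 0 y :> 'rV[A]_(1
    + m).
    by rewrite scale_row_mx add_row_mx scaler0 addr0.
  rewrite (pairE a p q (row_mx 0 x : 'rV_(1 + m)) (row_mx 0 y : 'rV_(1 + m))).
  by rewrite mulmxDl -scalemxAl linearP.
have F'pairE b p (x : 'rV[A]_m.+1) :
    F' (b *: w + F (p, x)) = (p, b *: delta_mx 0 0 + x).
  by rewrite F'lin FK wE FK [LHS]surjective_pairing /= scaler0 add0r.
have [PhiL PhiE] := to_linear Phi_lin.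
exists PhiL; exists Psi => [[p x]|y]; rewrite PhiE.
  rewrite /Psi /Phi /= row_mx0_rsubmx mulmxDl -scalemxAl -rowE G0 -mulmxA HG
    mulmx1.
  by rewrite F'pairE /= rsubmx_delta00 row_mxKr.
rewrite /Phi /Psi /=; set Y := row_mx 0 y; case E : (F' (Y *m G)) => [p z] /=.
have FE : F (p, z) = Y *m G by rewrite -E F'K.
rewrite row_mx0_rsubmx.
have := pairE (- z 0 0) 0 p (delta_mx 0 0) z; rewrite scaler0 add0r => ->.
rewrite -wE FE mulmxDl -scalemxAl wH -mulmxA GH mulmx1 rsubmx_delta00.
exact: row_mxKr.
Qed.

Lemma Hermite_rows : Hermite A <-> rows_completable (powers (1 : A)).
Proof.
split; first exact: Hermite_rows_completable.
move=> cA P _ _ [m [n]].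
have [A1|A1] := eqVneq (1 : A) 0.
  move=> _; exists (fun=> False); split=> [s c us sB _ b bs|x].
    by case: (sB b bs).
  exists [::], (fun=> 0); split=> //.
  by rewrite big_nil -[x]scale1r A1 scale0r.
elim: m n => [|m IHm] n; first exact: free_module_row.
by move=> /(rows_completable_cancel cA A1)[N']; apply: IHm.
Qed.

End HermiteRows.

Lemma Hermite_localization (A : comPzRingType) (S : mulrClosed A) :
  (forall s, s \in S -> GRing.lreg s) ->
  Hermite (localization S) <-> rows_completable S.
Proof.
move=> regS; apply: (iff_trans (Hermite_rows _)).
exact: rows_completable_localization.
Qed.

Theorem theorem1p2 (R : comNzRingType) (hR : local_ring R) :
  [<-> Hermite {poly R};
       Hermite (laurent_poly R);
       Hermite (monic_localization R);
       Hermite (laurent_series R)].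
Proof.
have [k [f [/choice[g gK] unit_f]]] := local_residue_field hR.
have Hpoly := Hermite_rows {poly R}.
have Hlpoly : Hermite (laurent_poly R) <-> rows_completable (powers ('X : {poly
  R})).
  apply: Hermite_localization => _ /powersP[n ->]; exact/monic_lreg/monicXn.
have Hmonic : Hermite (monic_localization R) <->
    rows_completable (@monic_pred R : {pred {poly R}}).
  by apply: Hermite_localization => p; apply: monic_lreg.
have Hseries : Hermite (laurent_series R) <-> rows_completable (powers (psX R)).
  by apply: Hermite_localization => _ /powersP[n ->]; apply: psXn_lreg.
have series_to_monic (c : rows_completable (powers (psX R))) :
    rows_completable (@monic_pred R : {pred {poly R}}).
  exact/comonic_to_monic/laurent_series_to_comonic.
tfae.
- move=> /Hpoly c; apply/Hlpoly; apply: (poly_to_laurent_poly gK unit_f c).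
  exact: poly_to_laurent_series gK unit_f c.
- move=> /Hlpoly c; apply/Hmonic/series_to_monic.
  exact: laurent_poly_to_laurent_series gK unit_f c.
- move=> /Hmonic c; apply/Hseries/comonic_to_laurent_series.
  exact: monic_to_comonic.
- move=> /Hseries c; apply/Hpoly; exact: laurent_series_to_poly gK unit_f c.
Qed.
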